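(* Let $k,l\geqslant 2$ be integers with $k+l\leqslant 8$ and let $M=S^{k+1}\times S^l$ or $M=S^{k+l+1}$. Let $g_c$ be the cone metric, let $\mathscr T_{TT}^0(M)$ be the space of smooth symmetric $(0,2)$-tensors that are transverse-traceless for $g_c$ and vanish in a neighbourhood of the singular orbits, and let $Q_c:\mathscr T_{TT}^0(M)\to\mathbb R$ be defined by $$Q_c(T)=\langle\Delta_L^cT,T\rangle_c,$$ where $\Delta_L^c$ is the Lichnerowicz Laplacian of $g_c$ and $\langle\cdot,\cdot\rangle_c$ is the $L^2$ scalar product for $g_c$. Then for every $N\in\mathbb N$ there exists an $N$-dimensional vector space $E_c^N\subset\mathscr T_{TT}^0(M)$ such that $$\forall T\in E_c^N\setminus\{0\},\quad Q_c(T)<0.$$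
   Context: The group $G=SO(k+1)\times SO(l+1)$ acts on $M$ with cohomogeneity one (linearly on $S^{k+1}\subset\mathbb R^{k+1}\oplus\mathbb R$ and $S^l\subset\mathbb R^{l+1}$, respectively on $S^{k+l+1}\subset\mathbb R^{k+1}\oplus\mathbb R^{l+1}$), with principal orbits $S^k\times S^l$ and two singular orbits; the complement of the singular orbits is identified with $(0,\pi)\times S^k\times S^l$ (coordinate $t\in(0,\pi)$). Cone metric: $g_c=dt^2+f_c(t)^2g^k+h_c(t)^2g^l$ with $f_c(t)=\sqrt{\frac{k-1}{k+l-1}}\sin t$, $h_c(t)=\sqrt{\frac{l-1}{k+l-1}}\sin t$, where $g^n$ is the round metric of curvature $1$ on $S^n$. It is smooth and Einstein with constant $\Lambda=k+l$ on $(0,\pi)\times S^k\times S^l$ and singular at the singular orbits ($t=0,\pi$). A tensor vanishing near the singular orbits is thus one with compact support in $(0,\pi)\times S^k\times S^l$. Lichnerowicz Laplacian: $\Delta_LT=\nabla^*\nabla T+\mathfrak R(T)$, where $\mathfrak R(T)(X,Y)=T(\operatorname{Ric}(X),Y)+T(X,\operatorname{Ric}(Y))-2\mathring R(T)(X,Y)$ and $\mathring R(T)(X,Y)=\sum_AT(R(X,e_A)Y,e_A)$ for an orthonormal basis $(e_A)$, with the curvature sign convention $R(X,Y)=\nabla_{[X,Y]}-[\nabla_X,\nabla_Y]$ (Besse), so that $\mathring R(g)=\operatorname{Ric}$. Transverse-traceless (TT) means divergence-free and trace-free. *)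

(* Defs.v *)
From HB Require Import structures.
From mathcomp Require Import all_boot all_order all_algebra.
From mathcomp Require Import all_classical all_reals all_analysis.

Set Implicit Arguments.
Unset Strict Implicit.
Unset Printing Implicit Defensive.

Import Order.TTheory GRing.Theory Num.Theory.
Import numFieldNormedType.Exports.

Local Open Scope classical_set_scope.
Local Open Scope ring_scope.

(** A metric and a (0,2)-tensor are given by their matrices of components
    [g x i j], [T x i j] in the coordinate frame [∂_i].  Traces over an
    orthonormal basis are written as contractions with the inverse metric. *)

Section CoordinateGeometry.
Context {R : realType} {n : nat}.
Implicit Types (g S T : 'rV[R]_n -> 'M[R]_n) (x : 'rV[R]_n).

Definition partial (i : 'I_n) (f : 'rV[R]_n -> R) : 'rV[R]_n -> R :=
  'D_(delta_mx 0 i) f.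

(** [∇_{∂_i} ∂_j = \sum_m christoffel g m i j ∂_m] (Levi-Civita). *)
Definition christoffel g (m i j : 'I_n) x : R :=
  2^-1 * \sum_p invmx (g x) m p *
    (partial i (fun y => g y p j) x + partial j (fun y => g y i p) x
     - partial p (fun y => g y i j) x).

(** [nabla g T a i j = (∇_{∂_a} T)(∂_i, ∂_j)]. *)
Definition nabla g T (a i j : 'I_n) x : R :=
  partial a (fun y => T y i j) x
  - \sum_p (christoffel g p a i x * T x p j + christoffel g p a j x * T x i p).

(** [nabla2 g T b a i j = (∇_{∂_b} (∇T))(∂_a, ∂_i, ∂_j)], where
    [(∇T)(X, Y, Z) = (∇_X T)(Y, Z)]. *)
Definition nabla2 g T (b a i j : 'I_n) x : R :=
  partial b (fun y => nabla g T a i j y) x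
  - \sum_p (christoffel g p b a x * nabla g T p i j x
            + christoffel g p b i x * nabla g T a p j x
            + christoffel g p b j x * nabla g T a i p x).

(** [R(∂_i, ∂_j) ∂_k = \sum_m curv g i j k m ∂_m] with Besse's sign convention
    [R(X, Y) = ∇_{[X,Y]} - [∇_X, ∇_Y]]. *)
Definition curv g (i j k m : 'I_n) x : R :=
  - (partial i (fun y => christoffel g m j k y) x
     - partial j (fun y => christoffel g m i k y) x
     + \sum_p (christoffel g p j k x * christoffel g m i p x
               - christoffel g p i k x * christoffel g m j p x)).

(** [Ric(X, Y)] is the trace of [Z |-> R(X, Z) Y]; for the sign convention
    above the round sphere has positive Ricci curvature. *)
Definition ricci g x : 'M[R]_n := \matrix_(i, j) \sum_a curv g i a j a x.

(** [(R° T)(X, Y) = \sum_A T(R(X, e_A) Y, e_A)]. *)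
Definition ring_curv g T x : 'M[R]_n :=
  \matrix_(i, j) \sum_a \sum_b
    invmx (g x) a b * \sum_m curv g i a j m x * T x m b.

(** [∇^*∇ T = - \sum_A (∇_{e_A} (∇T))(e_A, ., .)]. *)
Definition rough_laplacian g T x : 'M[R]_n :=
  \matrix_(i, j) (- \sum_a \sum_b invmx (g x) a b * nabla2 g T a b i j x).

(** The two middle terms are [T(Ric(X), Y)] and [T(X, Ric(Y))]. *)
Definition lichnerowicz g T x : 'M[R]_n :=
  rough_laplacian g T x
  + (ricci g x *m invmx (g x) *m T x + T x *m invmx (g x) *m ricci g x
     - 2 *: ring_curv g T x).

Definition divergence g T (j : 'I_n) x : R :=
  - \sum_a \sum_b invmx (g x) a b * nabla g T a b j x.

Definition metric_trace g T x : R := \sum_a \sum_b invmx (g x) a b * T x a b.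

(** [<S, T>_g = g^{ia} g^{jb} S_{ij} T_{ab}]. *)
Definition tensor_inner g S T x : R :=
  \tr (invmx (g x) *m S x *m invmx (g x) *m (T x)^T).

Definition volume_density g x : R := Num.sqrt (\det (g x)).

End CoordinateGeometry.

(** By Fubini this is the integral for the n-dimensional Lebesgue measure as soon
    as the iterated integrals converge absolutely; it is only used for bounded
    functions times the density of the round metric on R^n. *)
Fixpoint Rn_integral {R : realType} {n : nat} : ('rV[R]_n -> R) -> R :=
  match n with
  | 0%N => fun F => F 0
  | n'.+1 => fun F =>
      \int[@lebesgue_measure R]_s
        Rn_integral (fun z : 'rV[R]_n' => F (row_mx (s%:M : 'M[R]_1) z))
  end.

Definition smooth_on {R : realType} {m : nat} {W : normedModType R}
    (U : set 'rV[R]_m) (F : 'rV[R]_m -> W) : Prop :=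
  forall (s : seq 'I_m) p, U p ->
    differentiable (foldr (fun i G => 'D_(delta_mx 0 i) G) F s) p.

Definition subspace_of_dim {R : realType} {V : lmodType R} (N : nat)
    (E : set V) : Prop :=
  exists e : 'I_N -> V,
    (forall c : 'I_N -> R, \sum_i c i *: e i = 0 -> forall i, c i = 0) /\
    E = [set \sum_i c i *: e i | c in [set: 'I_N -> R]].

Definition dotp {R : realType} {m : nat} (x y : 'rV[R]_m) : R :=
  (x *m y^T) 0 0.

Definition sphere (R : realType) (n : nat) : set 'rV[R]_(1 + n) :=
  [set x | dotp x x = 1].
Arguments sphere : clear implicits.

(** Inverse stereographic projection R^n -> S^n from the pole with first
    coordinate [(-1)^b]; for [b = true, false] these two maps parametrize the
    whole sphere, and each of them misses one point only. *)
Definition stereo {R : realType} {n : nat} (b : bool) (u : 'rV[R]_n) :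
    'rV[R]_(1 + n) :=
  (1 + dotp u u)^-1 *:
    row_mx (((-1) ^+ b * (dotp u u - 1))%:M : 'M[R]_1) (2 *: u).

(** [SphereProduct] is S^(k+1) x S^l in (R^(k+1) + R) + R^(l+1) and
    [Sphere] is S^(k+l+1) in R^(k+1) + R^(l+1). *)
Inductive model := SphereProduct | Sphere.

Definition ambient_dim (M : model) (k l : nat) : nat :=
  match M with
  | SphereProduct => (((1 + k) + 1) + (1 + l))%N
  | Sphere => ((1 + k) + (1 + l))%N
  end.

Section Manifold.
Context {R : realType}.
Variables (M : model) (k l : nat).

Local Notation ambient := 'rV[R]_(ambient_dim M k l).

Definition carrier : set ambient :=
  match M return set 'rV[R]_(ambient_dim M k l) with
  | SphereProduct => [set p | dotp (lsubmx p) (lsubmx p) = 1 /\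
                              dotp (rsubmx p) (rsubmx p) = 1]
  | Sphere => [set p | dotp p p = 1]
  end.

Definition tangent : ambient -> set ambient :=
  match M return 'rV[R]_(ambient_dim M k l) ->
                 set 'rV[R]_(ambient_dim M k l) with
  | SphereProduct => fun p => [set v | dotp (lsubmx v) (lsubmx p) = 0 /\
                                       dotp (rsubmx v) (rsubmx p) = 0]
  | Sphere => fun p => [set v | dotp v p = 0]
  end.

(** For [t] in [0, pi] the set of all [orbit_map t x y], with [x] in S^k and
    [y] in S^l, is an orbit of SO(k+1) x SO(l+1); it is principal, and a copy
    of S^k x S^l, for [0 < t < pi].  At [t = 0] the factor S^k collapses; at
    [t = pi] it is S^k for S^(k+1) x S^l and S^l for S^(k+l+1). *)
Definition orbit_map : R -> 'rV[R]_(1 + k) -> 'rV[R]_(1 + l) -> ambient :=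
  match M return R -> 'rV[R]_(1 + k) -> 'rV[R]_(1 + l) ->
                 'rV[R]_(ambient_dim M k l) with
  | SphereProduct => fun t x y =>
      row_mx (row_mx (sin t *: x) ((cos t)%:M : 'M[R]_1)) y
  | Sphere => fun t x y => row_mx (sin (t / 2) *: x) (cos (t / 2) *: y)
  end.

Definition singular_orbits : set ambient :=
  [set p | exists t x y, [/\ t = 0 \/ t = pi, sphere R k x, sphere R l y &
                             p = orbit_map t x y]].

Local Notation coord := 'rV[R]_((1 + k) + l).

Definition coord_t (z : coord) : 'rV[R]_1 := lsubmx (lsubmx z).
Definition coord_x (b : bool) (z : coord) : 'rV[R]_(1 + k) :=
  stereo b (rsubmx (lsubmx z)).
Definition coord_y (b : bool) (z : coord) : 'rV[R]_(1 + l) :=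
  stereo b (rsubmx z).

Definition coord_domain : set coord := [set z | 0 < coord_t z 0 0 < pi].

(** For [b, c] in [bool] the images of these four maps cover the principal part
    (0, pi) x S^k x S^l of M. *)
Definition chart (b c : bool) (z : coord) : ambient :=
  orbit_map (coord_t z 0 0) (coord_x b z) (coord_y c z).

Definition f_c (t : R) : R :=
  Num.sqrt ((k%:R - 1) / (k%:R + l%:R - 1)) * sin t.
Definition h_c (t : R) : R :=
  Num.sqrt ((l%:R - 1) / (k%:R + l%:R - 1)) * sin t.

(** Pull-back of the Euclidean inner product; for [coord_x] and [coord_y] it
    is the round metric g^k, resp. g^l, of the unit sphere. *)
Definition pullback_euclidean (m : nat) (F : coord -> 'rV[R]_m) (z : coord) :
    'M[R]_((1 + k) + l) :=
  'J F z *m ('J F z)^T.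

Definition cone_metric (b c : bool) (z : coord) : 'M[R]_((1 + k) + l) :=
  pullback_euclidean coord_t z
  + f_c (coord_t z 0 0) ^+ 2 *: pullback_euclidean (coord_x b) z
  + h_c (coord_t z 0 0) ^+ 2 *: pullback_euclidean (coord_y c) z.

(** A (0,2)-tensor at a point [p] of M is a bilinear form on [tangent p]; it is
    encoded by the matrix of its extension to the ambient space that vanishes
    on the orthogonal complement of [tangent p].  Outside M a tensor field takes
    the value 0, so that equality of tensor fields is equality of functions. *)

Local Notation tensor_field :=
  ('rV[R]_(ambient_dim M k l) -> 'M[R]_(ambient_dim M k l)).

Definition is_symmetric_tensor (T : tensor_field) : Prop :=
  [/\ forall p, (T p)^T = T p,
      forall p, ~ carrier p -> T p = 0
    & forall p nu, carrier p ->
        (forall v, tangent p v -> dotp nu v = 0) -> nu *m T p = 0].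

(** T is locally the restriction to M of a smooth map on the ambient space. *)
Definition is_smooth (T : tensor_field) : Prop :=
  forall p, carrier p -> exists U (F : tensor_field),
    [/\ open U, U p, smooth_on U F & forall q, U q -> carrier q -> T q = F q].

Definition vanishes_near_singular_orbits (T : tensor_field) : Prop :=
  exists U, [/\ open U, singular_orbits `<=` U &
                forall p, U p -> carrier p -> T p = 0].

(** The components of the pull-back of T by [chart b c]. *)
Definition components (b c : bool) (T : tensor_field) (z : coord) :
    'M[R]_((1 + k) + l) :=
  'J (chart b c) z *m T (chart b c z) *m ('J (chart b c) z)^T.

Definition is_TT (T : tensor_field) : Prop :=
  forall b c z, coord_domain z ->
    (forall j, divergence (cone_metric b c) (components b c T) j z = 0) /\
    metric_trace (cone_metric b c) (components b c T) z = 0.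

Definition TT0 : set tensor_field :=
  [set T | [/\ is_symmetric_tensor T, is_smooth T,
               vanishes_near_singular_orbits T & is_TT T]].

(** L^2 scalar product for g_c of two tensors given by their components in the
    chart [chart false false], whose image has a complement of measure 0. *)
Definition L2_inner (S T : coord -> 'M[R]_((1 + k) + l)) : R :=
  let g := cone_metric false false in
  \int[@lebesgue_measure R]_(t in `]0, pi[)
    Rn_integral (fun u : 'rV[R]_k => Rn_integral (fun v : 'rV[R]_l =>
      let z := row_mx (row_mx (t%:M : 'M[R]_1) u) v in
      tensor_inner g S T z * volume_density g z)).

Definition Q_c (T : tensor_field) : R :=
  L2_inner
    (lichnerowicz (cone_metric false false) (components false false T))
    (components false false T).

End Manifold.

Arguments TT0 R M k l : clear implicits.
Arguments Q_c R M k l : clear implicits.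

(* Main.v *)
Require Import Defs.
From HB Require Import structures.
From mathcomp Require Import all_boot all_order all_algebra.
From mathcomp Require Import all_classical all_reals all_analysis.
From mathcomp Require Import measurable_realfun ring lra.

Set Implicit Arguments.
Unset Strict Implicit.
Unset Printing Implicit Defensive.

Import Order.TTheory GRing.Theory Num.Theory.
Import numFieldNormedType.Exports.

Local Open Scope classical_set_scope.
Local Open Scope ring_scope.

(** The negative directions are tensors of the form
    T = phi(t) (f_c^2 g^k / k - h_c^2 g^l / l), which trade volume between the
    two spheres.  Write m = k + l.

    Both warping functions are multiples of sin, so the shape operator of the
    slices t = const is a multiple of the identity.  As T has no dt component, it
    is then divergence-free because it is trace-free, for every function phi,
    and the Lichnerowicz Laplacian preserves the family: it replaces phi by
      L phi = - phi'' - m cot phi' + (2m - 2(m-1)/sin^2) phi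
    ([divergence_warped], [lichnerowicz_warped]).  The pulled-back metric is
    diagonal in stereographic coordinates, and both statements are proved by
    computing with a diagonal metric whose entries have simple logarithmic
    derivatives.

    Near t = 0 the operator L is a Hardy operator with potential -2(m-1)/t^2,
    while Hardy's constant for t^m dt is (m-1)^2/4; the potential wins exactly
    when m < 9.  Put phi = sin^(-q) psi(u) with q = (m-1)/2 and
    u = log tan(t/2).  Then
      L phi = sin^(-q-2) (- psi'' - (gap + O(sin^2)) psi),
      gap = (m-1)(9-m)/4 >= 7/4  for 4 <= m <= 8
    ([lichnerowicz_test]).  The singular orbit is at u = -oo, so there is room
    for arbitrarily many disjoint intervals of fixed length on which sin is as
    small as desired.  On each of them there is a smooth function psi >= 0,
    positive inside and zero outside, with psi'' >= - psi everywhere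
    ([flat_bump_subsolution]).  For such a psi the product phi L phi is
    pointwise nonpositive and negative where phi > 0
    ([lichnerowicz_test_lt0]), so that the sign of Q_c needs no integration by
    parts and no Rayleigh quotient.

    Disjoint supports remove the cross terms: on a combination with
    coefficients a_j the radial integrand is the sum of the a_j^2 times those of
    the individual functions ([combined_energyE]).  Hence Q_c is negative as
    soon as some a_j is nonzero ([Q_c_combined_lt0]), and this also gives the
    linear independence of the N tensors. *)

(** * Directional derivatives *)

Section DerivativeRules.
Context {R : realType} {V : normedModType R}.
Implicit Types (f g : V -> R) (z v : V).

Lemma is_derive_fun_add f g z v df dg :
  is_derive z v f df -> is_derive z v g dg ->
  is_derive z v (fun y => f y + g y) (df + dg).
Proof. by move=> ? ?; exact: is_deriveD. Qed.

Lemma is_derive_fun_mul f g z v df dg :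
  is_derive z v f df -> is_derive z v g dg ->
  is_derive z v (fun y => f y * g y) (df * g z + f z * dg).
Proof.
move=> hf hg; apply: is_derive_eq (is_deriveM hf hg) _.
by rewrite addrC /GRing.scale/= [g z * _]mulrC.
Qed.

Lemma is_derive_fun_inv f z v df :
  f z != 0 -> is_derive z v f df ->
  is_derive z v (fun y => (f y)^-1) (- df * ((f z)^-1 * (f z)^-1)).
Proof.
move=> fz hf; have [d1 <-] := hf.
split; first exact: derivableV.
by rewrite deriveV// /GRing.scale/= -exprVn expr2 mulNr mulNr mulrC.
Qed.

Lemma derive_line f z v : 'D_1 (fun s : R => f (s *: v + z)) (0 : R) = 'D_v f z.
Proof.
rewrite /derive; set g1 := fun h => _; set g2 := fun h => _.
have -> // : g1 = g2.
apply/funext => s; rewrite /g1 /g2 /=.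
by rewrite addr0 scale0r add0r [_%:A]mulr1.
Qed.

(** The chain rule along the line z + s v: only a directional derivative of f is
    assumed, so the inner function need not be differentiable in all directions. *)
Lemma is_derive_fun_comp (h : R -> R) f z v df dh :
  is_derive (f z) 1 h dh -> is_derive z v f df ->
  is_derive z v (fun y => h (f y)) (dh * df).
Proof.
move=> hh hf.
pose k := fun s : R => f (s *: v + z).
have k0 : k 0 = f z by rewrite /k scale0r add0r.
have dk : is_derive (0 : R) 1 k df.
  have [df1 df2] := hf; split; first exact: (derivable1P f z v).1.
  by rewrite -df2 derive_line.
have [d1 d2] : is_derive (0 : R) 1 (h \o k) (dh * df).
  by apply: is_derive1_comp; rewrite k0.
split; first exact: (derivable1P (fun y => h (f y)) z v).2.
by rewrite -d2 -derive_line.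
Qed.

Lemma is_derive_fun_sum n (f : 'I_n -> V -> R) z v (df : 'I_n -> R) :
  (forall i, is_derive z v (f i) (df i)) ->
  is_derive z v (fun y => \sum_i f i y) (\sum_i df i).
Proof.
move=> h; have := is_derive_sum h.
by congr (is_derive _ _ _ _); apply/funext => y; rewrite fct_sumE.
Qed.

(** Iterated partial derivatives are known in closed form only on an open set,
    while differentiability is asserted for the derivative itself; this carries
    it over. *)
Lemma near_eq_differentiable {W : normedModType R} (f g : V -> W) z :
  (\near z, f z = g z) -> differentiable f z -> differentiable g z.
Proof.
move=> fg df.
have g_expansion : g \o shift z = cst (g z) + 'd f z +o_ 0 id.
  apply/eqaddoP => e e0; have := diff_locally df.
  move=> /eqaddoE/eqaddoP/(_ e e0); apply: filter_app.
  have : \forall y \near 0, f (y + z) = g (y + z).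
    have shift_cvg : (fun y => y + z) @ (0 : V) --> z.
      by rewrite -[X in _ --> X]add0r; apply: cvgD; [exact: cvg_id|exact: cvg_cst].
    exact: (shift_cvg _ fg).
  by apply: filter_app; near=> y => e1; rewrite !fctE /= -e1 -(nbhs_singleton fg).
by apply/diff_locallyP; rewrite (diff_unique (diff_continuous df) g_expansion);
  split => //; exact: (diff_continuous df).
Unshelve. all: by end_near. Qed.

End DerivativeRules.

Section CoordinateDerivatives.
Context {R : realType}.

Lemma is_derive_coord m (i a : 'I_m) (z : 'rV[R]_m) :
  is_derive z (delta_mx 0 a) (fun y : 'rV[R]_m => y 0 i) (i == a)%:R.
Proof.
have d : differentiable (fun y : 'rV[R]_m => y 0 i) z
  by exact: differentiable_coord.
split; first exact: diff_derivable.
rewrite deriveE// (_ : 'd _ _ = (fun y : 'rV[R]_m => y 0 i) :> (_ -> _)).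
  by rewrite mxE eqxx.
have lin : linear (fun y : 'rV[R]_m => y 0 i) by move=> c x y; rewrite !mxE.
pose scallM := GRing.isLinear.Build _ _ _ _ _ lin.
pose L : {linear 'rV[R]_m -> R} := HB.pack (fun y : 'rV[R]_m => y 0 i) scallM.
by apply: (@diff_lin _ _ _ L); exact: coord_continuous.
Qed.

Lemma is_derive_const_fun {V : normedModType R} (c : R) (z v : V) :
  is_derive z v (fun _ : V => c) 0.
Proof. exact: is_derive_cst. Qed.

Lemma differentiable_mx {V : normedModType R} m n (F : V -> 'M[R]_(m, n)) z :
  (forall i j, differentiable (fun y => F y i j) z) -> differentiable F z.
Proof.
move=> dF.
have -> : F = \sum_i \sum_j (fun y => F y i j *: delta_mx i j).
  by apply/funext => y; rewrite {1}[F y]matrix_sum_delta !fct_sumE;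
    apply: eq_bigr => i _; rewrite fct_sumE.
by apply: differentiable_sum => i; apply: differentiable_sum => j;
  apply: differentiableZl.
Qed.

Lemma is_derive_mx {V : normedModType R} m n (F : V -> 'M[R]_(m, n)) z v (dF : 'M[R]_(m, n)) :
  (forall i j, is_derive z v (fun y => F y i j) (dF i j)) ->
  is_derive z v F dF.
Proof.
move=> h; have d : derivable F z v by apply/derivable_mxP => i j.
split => //; rewrite derive_mx//; apply/matrixP => i j; rewrite mxE.
by have [_ ->] := h i j.
Qed.

End CoordinateDerivatives.

(** * A class of smooth functions closed under partial derivatives *)

(** Syntax trees of functions rather than a property of them: since every
    partial derivative of a tree agrees on [U] with another tree, smoothness
    follows by induction.  In [smooth_comp] a function of one variable comes
    with the whole sequence [h] of its derivatives. *)
Inductive smooth_fun {R : realType} {m : nat} (U : set 'rV[R]_m) :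
    ('rV[R]_m -> R) -> Prop :=
| smooth_cst c : smooth_fun U (fun=> c)
| smooth_coord i : smooth_fun U (fun p => p 0 i)
| smooth_add f g : smooth_fun U f -> smooth_fun U g ->
    smooth_fun U (fun p => f p + g p)
| smooth_mul f g : smooth_fun U f -> smooth_fun U g ->
    smooth_fun U (fun p => f p * g p)
| smooth_inv f : smooth_fun U f -> (forall p, U p -> f p != 0) ->
    smooth_fun U (fun p => (f p)^-1)
| smooth_comp (h : nat -> R -> R) (D : set R) f n :
    (forall n x, D x -> is_derive x 1 (h n) (h n.+1 x)) ->
    smooth_fun U f -> (forall p, U p -> D (f p)) ->
    smooth_fun U (fun p => h n (f p)).

Section SmoothFunctions.
Context {R : realType} {m : nat} (U : set 'rV[R]_m).

Lemma smooth_fun_sum (I : Type) (r : seq I) (P : pred I)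
    (f : I -> 'rV[R]_m -> R) :
  (forall i, smooth_fun U (f i)) ->
  smooth_fun U (fun p => \sum_(i <- r | P i) f i p).
Proof.
move=> h; elim: r => [|i r ih].
  by under eq_fun do rewrite big_nil; exact: smooth_cst.
under eq_fun do rewrite big_cons.
by case: (P i) => //; exact: smooth_add.
Qed.

Lemma smooth_fun_differentiable f p :
  smooth_fun U f -> U p -> differentiable f p.
Proof.
move=> sf Up; elim: sf => [c|i|{}f g _ df _ dg|{}f g _ df _ dg|{}f _ df f0|h D {}f n hh _ df fD].
- exact: differentiable_cst.
- exact: differentiable_coord.
- exact: differentiableD.
- exact: differentiableM.
- by apply: differentiableV => //; exact: f0.
- apply: (@differentiable_comp _ _ _ _ f (h n)) => //.
  by apply/derivable1_diffP; have [] := hh n (f p) (fD p Up).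
Qed.

(** Closure under partial derivatives, which is all that smoothness needs; the
    derivative of [h n] contributes the next member of the sequence. *)
Lemma smooth_fun_derive f (i : 'I_m) : smooth_fun U f ->
  exists2 f', smooth_fun U f' &
    forall p, U p -> is_derive p (delta_mx 0 i) f (f' p).
Proof.
elim => [c|j|{}f g sf [f' sf' df] sg [g' sg' dg]|{}f g sf [f' sf' df] sg [g' sg' dg]
        |{}f sf [f' sf' df] f0|h D {}f n hh sf [f' sf' df] fD].
- by exists (fun=> 0); [exact: smooth_cst|move=> p _; exact: is_derive_const_fun].
- exists (fun=> (j == i)%:R); first exact: smooth_cst.
  by move=> p _; exact: is_derive_coord.
- exists (fun p => f' p + g' p); first exact: smooth_add.
  by move=> p Up; apply: is_derive_fun_add; [exact: df|exact: dg].
- exists (fun p => f' p * g p + f p * g' p).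
    by apply: smooth_add; exact: smooth_mul.
  by move=> p Up; apply: is_derive_fun_mul; [exact: df|exact: dg].
- exists (fun p => (-1 * f' p) * ((f p)^-1 * (f p)^-1)).
    apply: smooth_mul; first by apply: smooth_mul => //; exact: smooth_cst.
    by apply: smooth_mul; exact: smooth_inv.
  by move=> p Up; rewrite mulN1r; apply: is_derive_fun_inv; [exact: f0|exact: df].
- exists (fun p => h n.+1 (f p) * f' p).
    by apply: smooth_mul => //; exact: (@smooth_comp _ _ _ h D).
  move=> p Up; apply: is_derive_fun_comp; last exact: df.
  by apply: hh; exact: fD.
Qed.

(** By induction on the list of indices the iterated derivative agrees on [U]
    with a matrix whose entries are again in the class. *)
Lemma smooth_on_mx a b (F : 'rV[R]_m -> 'M[R]_(a, b)) :
  open U -> (forall i j, smooth_fun U (fun p => F p i j)) -> smooth_on U F.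
Proof.
move=> oU sF s.
have [F' sF' eF'] : exists2 F' : 'rV[R]_m -> 'M[R]_(a, b),
    (forall i j, smooth_fun U (fun p => F' p i j)) &
    forall p, U p ->
      foldr (fun i G => 'D_(delta_mx 0 i) G) F s p = F' p.
  elim: s => [|c s [F' sF' eF']]; first by exists F.
  have H i j := smooth_fun_derive c (sF' i j).
  pose F'' := fun p => \matrix_(i, j) s2val (cid2 (H i j)) p.
  exists F''.
    move=> i j; rewrite /F''; under eq_fun do rewrite mxE.
    by case: (cid2 (H i j)).
  move=> p Up /=; rewrite (@near_eq_derive _ _ _ _ F').
    have [_ ->//] : is_derive p (delta_mx 0 c) F' (F'' p).
    apply: is_derive_mx => i j; rewrite mxE.
    by case: (cid2 (H i j)) => /= f'' _; apply.
  by apply: filterS (open_nbhs_nbhs (conj oU Up)) => q; exact: eF'.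
move=> p Up; apply: (@near_eq_differentiable _ _ _ F').
  by apply: filterS (open_nbhs_nbhs (conj oU Up)) => q Uq; rewrite eF'.
by apply: differentiable_mx => i j; exact: smooth_fun_differentiable.
Qed.

End SmoothFunctions.

(** * Diagonal metrics *)

Section Kronecker.
Context {R : realType} {n : nat}.
Implicit Types (F : 'I_n -> R) (i : 'I_n).

Lemma sum_delta_l F i : \sum_p (p == i)%:R * F p = F i.
Proof.
rewrite (bigD1 i)//= eqxx mul1r big1 ?addr0// => p /negbTE->.
by rewrite mul0r.
Qed.

Lemma sum_delta_r F i : \sum_p (i == p)%:R * F p = F i.
Proof. by under eq_bigr do rewrite eq_sym; exact: sum_delta_l. Qed.

Definition diag_metric (G : 'I_n -> 'rV[R]_n -> R) (z : 'rV[R]_n) : 'M[R]_n :=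
  diag_mx (\row_i G i z).

Lemma diag_metricE G z i j : diag_metric G z i j = (i == j)%:R * G i z.
Proof. by rewrite !mxE mulr_natl; case: eqP => // ->. Qed.

Lemma invmx_diag_metric G z : (forall i, G i z != 0) ->
  invmx (diag_metric G z) = diag_metric (fun i y => (G i y)^-1) z.
Proof.
move=> G0.
have mulD : diag_metric (fun i y => (G i y)^-1) z *m diag_metric G z = 1%:M.
  rewrite /diag_metric mulmx_diag -diag_const_mx; congr diag_mx.
  by apply/rowP => i; rewrite !mxE mulVf.
have uD : diag_metric G z \in unitmx by exact: (mulmx1_unit mulD).2.
by rewrite -[LHS]mul1mx -mulD mulmxK.
Qed.

Lemma det_diag_metric G z : \det (diag_metric G z) = \prod_i G i z.
Proof. by rewrite det_diag; apply: eq_bigr => i _; rewrite mxE. Qed.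

End Kronecker.

Lemma partialE {R : realType} {n : nat} (f : 'rV[R]_n -> R) a z df :
  is_derive z (delta_mx 0 a) f df -> partial a f z = df.
Proof. by case. Qed.

Lemma partial_near {R : realType} {n : nat} (D : set 'rV[R]_n)
    (f h : 'rV[R]_n -> R) a z df :
  open D -> D z -> (forall y, D y -> f y = h y) ->
  is_derive z (delta_mx 0 a) h df -> partial a f z = df.
Proof.
move=> oD Dz fh [_ <-]; apply: near_eq_derive.
by apply: filterS (open_nbhs_nbhs (conj oD Dz)) => y; exact: fh.
Qed.

(** * Curvature of a product warped by the sine *)

Section WarpedProduct.
Context {R : realType} {n : nat} (i0 : 'I_n) (bl : 'I_n -> nat)
  (gam : nat -> R).
Hypothesis bl0 : forall i, (bl i == bl i0) = (i == i0).
Hypothesis gam0 : forall i, gam (bl i) != 0.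
Implicit Types (z y : 'rV[R]_n) (a b i j p : 'I_n).

Definition regular_points : set 'rV[R]_n := [set z | 0 < sin (z 0 i0)].
Local Notation D := regular_points.

(** The factor 2 / (1 + |u|^2) by which inverse stereographic projection
    scales lengths, u being the coordinates in block [c]. *)
Definition conformal (c : nat) z : R :=
  2 / (1 + \sum_(p | bl p == c) z 0 p ^+ 2).

(** The diagonal entries of dt^2 + sum_c gam_c sin(t)^2 g_c, where t is the
    coordinate [i0] and g_c is the round metric on the coordinates of block [c]. *)
Definition warped i z : R :=
  if i == i0 then 1
  else gam (bl i) * sin (z 0 i0) ^+ 2 * conformal (bl i) z ^+ 2.

Definition cot z : R := cos (z 0 i0) / sin (z 0 i0).

(** Half the logarithmic derivative of [warped i] in direction [a].  All
    Christoffel symbols of a diagonal metric are linear in these, up to quotients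
    of two metric coefficients. *)
Definition log_slope a i z : R :=
  if i == i0 then 0 else if a == i0 then cot z
  else if bl a == bl i then - (conformal (bl i) z * z 0 a) else 0.

Definition log_slope_derivative b a i z : R :=
  if i == i0 then 0
  else if a == i0 then (if b == i0 then - (sin (z 0 i0))^-2 else 0)
  else if bl a == bl i then
    if bl b == bl i then
      - (conformal (bl i) z * (a == b)%:R
         - conformal (bl i) z * z 0 a * (conformal (bl i) z * z 0 b))
    else 0
  else 0.

Local Notation G := warped.
Local Notation rho := conformal.
Local Notation lam := log_slope.
Local Notation dlam := log_slope_derivative.
Local Notation g := (diag_metric warped).

Lemma open_regular_points : open D.
Proof.
rewrite (_ : D = (fun z => sin (z 0 i0)) @^-1` [set x | 0 < x])//.
apply: open_comp; last exact: open_gt.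
move=> z _; apply: (@continuous_comp _ _ _ (fun z : 'rV_n => z 0 i0)).
  exact: coord_continuous.
exact: continuous_sin.
Qed.

Lemma conformal_gt0 c z : 0 < rho c z.
Proof. by rewrite divr_gt0// ltr_pwDl// sumr_ge0// => p _; rewrite sqr_ge0. Qed.

Lemma conformalE c z :
  rho c z * (1 + \sum_(p | bl p == c) z 0 p ^+ 2) = 2.
Proof.
rewrite /conformal mulfVK// gt_eqF// ltr_pwDl// sumr_ge0// => p _.
by rewrite sqr_ge0.
Qed.

Lemma warped_neq0 i z : D z -> G i z != 0.
Proof.
move=> Dz; rewrite /warped; case: ifP => _; first exact: oner_neq0.
by apply: mulf_neq0; [apply: mulf_neq0 => //|]; apply: expf_neq0;
  rewrite gt_eqF// conformal_gt0.
Qed.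

Lemma warped0 z : G i0 z = 1. Proof. by rewrite /warped eqxx. Qed.

(** A metric coefficient depends on its block only, so the quotient of two
    coefficients of one block is 1; this is why the sectional curvatures below are
    constant on pairs of blocks. *)
Lemma warped_block i j z : bl i = bl j -> G i z = G j z.
Proof.
move=> e; rewrite /warped e.
by have := bl0 i; have := bl0 j; rewrite e => <- <-.
Qed.

Lemma is_derive_sin_coord z a :
  is_derive z (delta_mx 0 a) (fun y => sin (y 0 i0))
    (cos (z 0 i0) * (i0 == a)%:R).
Proof. exact: is_derive_fun_comp (is_derive_coord _ _ _). Qed.

Lemma is_derive_cos_coord z a :
  is_derive z (delta_mx 0 a) (fun y => cos (y 0 i0))
    (- sin (z 0 i0) * (i0 == a)%:R).
Proof. exact: is_derive_fun_comp (is_derive_coord _ _ _). Qed.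

Lemma is_derive_cot z a : D z ->
  is_derive z (delta_mx 0 a) cot (- (sin (z 0 i0))^-2 * (i0 == a)%:R).
Proof.
move=> Dz; have s0 : sin (z 0 i0) != 0 by rewrite gt_eqF.
apply: is_derive_eq (is_derive_fun_mul (is_derive_cos_coord z a)
  (is_derive_fun_inv s0 (is_derive_sin_coord z a))) _.
have := cos2Dsin2 (z 0 i0); move: s0.
set s := sin _; set c := cos _ => s0 e.
transitivity (- (c ^+ 2 + s ^+ 2) * s^-2 * (i0 == a)%:R); first by field.
by rewrite e mulN1r.
Qed.

Lemma is_derive_conformal z c a :
  is_derive z (delta_mx 0 a) (rho c)
    (if bl a == c then - (rho c z ^+ 2 * z 0 a) else 0).
Proof.
have dsum : is_derive z (delta_mx 0 a)
    (fun y => \sum_(p | bl p == c) y 0 p ^+ 2)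
    (if bl a == c then 2 * z 0 a else 0).
  have -> : (fun y : 'rV[R]_n => \sum_(p | bl p == c) y 0 p ^+ 2) =
      (fun y => \sum_p (bl p == c)%:R * (y 0 p * y 0 p)).
    apply/funext => y; rewrite big_mkcond/=; apply: eq_bigr => p _.
    by case: eqP; rewrite ?mul1r ?mul0r.
  apply: is_derive_eq; first apply: is_derive_fun_sum => p.
    apply: is_derive_fun_mul (is_derive_const_fun _ _ _)
      (is_derive_fun_mul (is_derive_coord _ _ _) (is_derive_coord _ _ _)).
  rewrite (eq_bigr (fun p => (p == a)%:R * ((bl p == c)%:R * (2 * z 0 p)))).
    by rewrite sum_delta_l; case: eqP; rewrite ?mul1r ?mul0r.
  by move=> p _; ring.
have n0 : 1 + \sum_(p | bl p == c) z 0 p ^+ 2 != 0.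
  by rewrite gt_eqF// ltr_pwDl// sumr_ge0// => p _; rewrite sqr_ge0.
have := is_derive_fun_mul (is_derive_const_fun 2 _ _) (@is_derive_fun_inv _ _
  (fun y => 1 + \sum_(p | bl p == c) y 0 p ^+ 2) _ _ _ n0 (is_derive_fun_add (is_derive_const_fun 1 _ _) dsum)).
move=> h; apply: is_derive_eq h _; rewrite /conformal.
by case: eqP => _; field.
Qed.

Lemma is_derive_warped z a i : D z ->
  is_derive z (delta_mx 0 a) (G i) (2 * lam a i z * G i z).
Proof.
move=> Dz; have s0 : sin (z 0 i0) != 0 by rewrite gt_eqF.
rewrite /warped /log_slope; case: (eqVneq i i0) => [_|ii0].
  by rewrite mulr0 mul0r; exact: is_derive_const_fun.
have := is_derive_fun_mul (is_derive_fun_mul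
  (is_derive_const_fun (gam (bl i)) z (delta_mx 0 a))
  (is_derive_fun_mul (is_derive_sin_coord z a)
  (is_derive_sin_coord z a))) (is_derive_fun_mul
  (is_derive_conformal z (bl i) a) (is_derive_conformal z (bl i) a)).
under eq_fun do rewrite -!expr2; move=> h; apply: is_derive_eq h _.
rewrite [i0 == a]eq_sym /cot; case: (eqVneq a i0) => [->|ai0].
  have -> : (bl i0 == bl i) = false by rewrite eq_sym bl0 (negbTE ii0).
  by rewrite mulr1n; field.
by rewrite mulr0n; case: eqP => _; ring.
Qed.

Lemma is_derive_log_slope z b a i : D z ->
  is_derive z (delta_mx 0 b) (lam a i) (dlam b a i z).
Proof.
move=> Dz; rewrite /log_slope /log_slope_derivative.
case: (eqVneq i i0) => [_|ii0]; first exact: is_derive_const_fun.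
case: (eqVneq a i0) => [_|ai0].
  apply: is_derive_eq (is_derive_cot b Dz) _.
  by rewrite eq_sym; case: eqP; rewrite ?mulr1 ?mulr0.
case: (eqVneq (bl a) (bl i)) => [ai|_]; last exact: is_derive_const_fun.
have := is_derive_fun_mul (is_derive_const_fun (-1) _ _) (is_derive_fun_mul
  (is_derive_conformal z (bl i) b) (is_derive_coord a b z)).
under eq_fun do rewrite mulN1r; move=> h; apply: is_derive_eq h _.
case: (eqVneq (bl b) (bl i)) => [bi|bi]; first by ring.
suff /negbTE-> : a != b by rewrite mulr0n; ring.
by apply: contraNneq bi => <-; rewrite ai.
Qed.

Lemma christoffel_warped z m i j : D z ->
  christoffel g m i j z =
    (m == j)%:R * lam i m z + (m == i)%:R * lam j m z
    - (i == j)%:R * (lam m i z * G i z / G m z).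
Proof.
move=> Dz; have G0 i' := warped_neq0 i' Dz.
have dg a p q : partial a (fun y => g y p q) z =
    (p == q)%:R * (2 * lam a p z * G p z).
  apply: partialE; under eq_fun do rewrite diag_metricE.
  apply: is_derive_eq (is_derive_fun_mul (is_derive_const_fun _ _ _)
    (is_derive_warped a p Dz)) _.
  by rewrite mul0r add0r.
rewrite /christoffel invmx_diag_metric//.
under eq_bigr do rewrite diag_metricE -mulrA !dg.
rewrite sum_delta_r.
case: (eqVneq m j) => [<-|mj]; case: (eqVneq m i) => [<-|mi];
  case: (eqVneq i m) => [e|im]; rewrite ?eqxx ?(negbTE mi) /=.
all: try (by rewrite e eqxx in mi); try (by rewrite e eqxx in mj);
  try (by rewrite eqxx in im); try (field; exact: G0).
all: case: (eqVneq i j) => [e2|ij]; rewrite ?(negbTE mi);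
  try (by rewrite -?e2 ?e eqxx in mj); try (field; split; exact: G0);
  try (field; exact: G0).
Qed.

Lemma christoffel_diag z a j : D z -> christoffel g a a j z = lam j a z.
Proof.
move=> Dz; rewrite christoffel_warped// eqxx mulfK ?warped_neq0//.
by rewrite mul1r addrAC subrr add0r.
Qed.

Lemma christoffel_offdiag z a i j : D z -> i != a ->
  christoffel g a i j z =
    (a == j)%:R * lam i a z - (i == j)%:R * (lam a i z * (G i z / G a z)).
Proof.
move=> Dz ia; rewrite christoffel_warped// [a == i]eq_sym (negbTE ia).
by rewrite mul0r addr0 -!mulrA.
Qed.

(** The radial index contributes cot^2.  For two indices of one block the other
    terms add up to rho^2 |u|^2 = 2 rho - rho^2, because rho (1 + |u|^2) = 2. *)
Lemma sum_log_slope z i a : D z -> i != a ->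
  \sum_p lam p i z * lam p a z * (G i z / G p z) =
    if (i == i0) || (a == i0) then 0
    else cot z ^+ 2 * G i z
         + (bl i == bl a)%:R * (2 * rho (bl i) z - rho (bl i) z ^+ 2).
Proof.
move=> Dz ia; rewrite /log_slope.
case: (eqVneq i i0) => [_|ii0] /=; first by rewrite big1// => p _; ring.
case: (eqVneq a i0) => [_|ai0] /=; first by rewrite big1// => p _; ring.
rewrite (bigD1 i0)//= eqxx warped0 divr1 expr2; congr (_ + _).
case: (eqVneq (bl i) (bl a)) => [e|e].
  rewrite mul1r -e.
  rewrite (_ : \sum_(_ | _) _ = \sum_(p | bl p == bl i) rho (bl i) z ^+ 2 * z 0 p ^+ 2).
    rewrite -mulr_sumr; have := conformalE (bl i) z.
    by set S := \sum_(_ | _) _; set r := rho _ _ => <-; ring.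
  rewrite [RHS]big_mkcond [LHS]big_mkcond/=; apply: eq_bigr => p _.
  case: (eqVneq p i0) => [->|pi0] /=.
    by rewrite eq_sym bl0 (negbTE ii0).
  case: (eqVneq (bl p) (bl i)) => [pi|_]; last by rewrite !mul0r.
  by rewrite (warped_block _ pi) divff ?warped_neq0// ; ring.
rewrite mul0r big1// => p pi0; rewrite (negbTE pi0).
case: (eqVneq (bl p) (bl i)) => [->|_]; last by rewrite !mul0r.
by rewrite (negbTE e) mulr0 mul0r.
Qed.

(** Sectional curvature of the plane spanned by two coordinate directions: 1 if
    it contains the radial direction, and by the Gauss equation the curvature of
    the fibre (0 for two different factors) minus cot^2 otherwise. *)
Definition sectional i a z : R :=
  if (i == i0) || (a == i0) then 1
  else (bl i == bl a)%:R / (gam (bl i) * sin (z 0 i0) ^+ 2) - cot z ^+ 2.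

(** Only curvature components with a repeated index occur in Ric and, for a
    diagonal tensor T, in the curvature term of the Lichnerowicz Laplacian.  For
    these the Christoffel symbols involved have one or two terms each, and the
    quadratic part collapses. *)
Lemma curv_warped_expansion z i a j : D z -> i != a ->
  curv g i a j a z =
  - (dlam i j a z
     - ((a == j)%:R * dlam a i a z
        - (i == j)%:R * (dlam a a i z * (G i z / G a z)
          + lam a i z * (2 * (lam a i z - lam a a z) * (G i z / G a z))))
     + ((lam j a z * lam i a z
         - (i == j)%:R * (lam a i z ^+ 2 * (G i z / G a z))
         + (a == j)%:R * (lam i a z * lam a i z))
        - (lam i j z * lam j a z + lam j i z * lam i a z
           - (i == j)%:R * \sum_p lam p i z * lam p a z * (G i z / G p z)))).
Proof.
move=> Dz ia; have G0 i' := warped_neq0 i' Dz.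
rewrite /curv; congr (- (_ - _ + _)).
- apply: (partial_near open_regular_points Dz (h := lam j a)).
    by move=> y Dy; rewrite christoffel_diag.
  exact: is_derive_log_slope.
- apply: (partial_near open_regular_points Dz).
    by move=> y Dy; rewrite christoffel_offdiag//.
  have dquot : is_derive z (delta_mx 0 a) (fun y => G i y / G a y)
      (2 * (lam a i z - lam a a z) * (G i z / G a z)).
    apply: is_derive_eq (is_derive_fun_mul (is_derive_warped a i Dz)
      (is_derive_fun_inv (G0 a) (is_derive_warped a a Dz))) _.
    by field.
  have := is_derive_fun_add (is_derive_fun_mul
      (is_derive_const_fun (a == j)%:R _ _) (is_derive_log_slope a i a Dz))
    (is_derive_fun_mul (is_derive_const_fun (- (i == j)%:R) _ _)
      (is_derive_fun_mul (is_derive_log_slope a a i Dz) dquot)).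
  under eq_fun do rewrite mulNr.
  by move=> h; apply: is_derive_eq h _; ring.
rewrite big_split/= sumrN; congr (_ - _).
  rewrite (eq_bigr (fun p => (a == p)%:R * (christoffel g p a j z * lam i a z)
    + (i == p)%:R * - (christoffel g p a j z * (lam a i z * (G i z / G a z))))).
    rewrite big_split/= !sum_delta_r christoffel_diag//.
    rewrite christoffel_warped// (negbTE ia) mul0r addr0.
    by case: (eqVneq a j) => [<-|_]; field; rewrite !G0.
  by move=> p _; rewrite [christoffel _ a i p z]christoffel_offdiag//; ring.
rewrite (eq_bigr (fun p => (p == j)%:R * (lam i p z * lam p a z)
  + (p == i)%:R * (lam j p z * lam p a z)
  + - (i == j)%:R * (lam p i z * lam p a z * (G i z / G p z)))).
  by rewrite !big_split/= !sum_delta_l -mulr_sumr mulNr.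
by move=> p _; rewrite christoffel_diag// christoffel_warped//; ring.
Qed.

Lemma inv_sin_sqr z : D z -> (sin (z 0 i0))^-2 = 1 + cot z ^+ 2.
Proof.
move=> Dz; have s0 : sin (z 0 i0) != 0 by rewrite gt_eqF.
rewrite /cot; have := cos2Dsin2 (z 0 i0); move: s0.
set s := sin _; set c := cos _ => s0 e.
by rewrite -[LHS]mul1r -[X in X * _]e; field.
Qed.

Lemma curv_warped z i a j : D z ->
  curv g i a j a z = ((i == j) && (a != i))%:R * (sectional i a z * G i z).
Proof.
move=> Dz; have s0 : sin (z 0 i0) != 0 by rewrite gt_eqF.
case: (eqVneq a i) => [->|ai].
  rewrite andbF mul0r /curv subrr add0r big1 ?oppr0// => p _.
  by rewrite subrr.
have ia : i != a by rewrite eq_sym.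
rewrite andbT curv_warped_expansion// sum_log_slope//.
have pyth := inv_sin_sqr Dz.
rewrite /sectional; case: (eqVneq i j) => [<-|ij].
  rewrite ?eqxx ?(negbTE ai) /log_slope /log_slope_derivative.
  case: (eqVneq i i0) => [ii|ii] /=.
    have ai0 : (a == i0) = false by rewrite -ii (negbTE ai).
    by rewrite ai0 ii warped0 pyth; ring.
  case: (eqVneq a i0) => [aa|aa] /=.
    by rewrite aa warped0 pyth; field.
  rewrite [bl a == bl i]eq_sym; case: (eqVneq (bl i) (bl a)) => [e|_] /=.
    rewrite -(warped_block z e) divff ?warped_neq0// -e !eqxx /warped (negbTE ii).
    by have gi := gam0 i; set c := cot z; rewrite !mulr1n; field; apply/andP.
  by rewrite !eqxx; ring.
rewrite /= !mul0r subr0 /log_slope /log_slope_derivative.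
case: (eqVneq a j) => [<-|aj] /=.
  rewrite ?eqxx.
  case: (eqVneq a i0) => [aa|aa]; case: (eqVneq i i0) => [ii|ii] /=.
  - by ring.
  - by ring.
  - have -> : (bl i == bl a) = false by rewrite eq_sym ii bl0 (negbTE aa).
    by ring.
  - by rewrite [bl a == bl i]eq_sym; case: (eqVneq (bl i) (bl a)) => [e|_] /=;
      rewrite -?e ?(negbTE ia) ?(negbTE ai) ?mulr0n; ring.
rewrite !mul0r.
case: (eqVneq a i0) => [aa|aa]; first by ring.
case: (eqVneq j i0) => [jj|jj].
  case: (eqVneq i i0) => [ii|ii]; first by rewrite ii jj eqxx in ij.
  by ring.
case: (eqVneq i i0) => [ii|ii].
  have -> : (bl i == bl a) = false by rewrite eq_sym ii bl0 (negbTE aa).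
  by case: ifP => _; ring.
case: (eqVneq (bl i) (bl a)) => [ia'|ia']; case: (eqVneq (bl j) (bl a)) => [ja|ja].
- by rewrite -ia' in ja *; rewrite ja [j == i]eq_sym (negbTE ij) eqxx mulr0n; ring.
- by rewrite ia' eq_sym (negbTE ja); ring.
- by rewrite ja (negbTE ia'); ring.
- by ring.
Qed.

End WarpedProduct.

(** * Transverse traceless tensors on a warped product *)

Section WarpedTT.
Context {R : realType} {n : nat} (i0 : 'I_n) (bl : 'I_n -> nat)
  (gam : nat -> R).
Hypothesis bl0 : forall i, (bl i == bl i0) = (i == i0).
Hypothesis gam0 : forall i, gam (bl i) != 0.
Hypothesis gamE : forall i, i != i0 ->
  \sum_(p | bl p == bl i) 1 - 1 = (n%:R - 2) * gam (bl i).
Implicit Types (z y : 'rV[R]_n) (a b i j p : 'I_n).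

Local Notation D := (regular_points i0).
Local Notation G := (warped i0 bl gam).
Local Notation g := (diag_metric (warped i0 bl gam)).
Local Notation lam := (log_slope i0 bl).
Local Notation cot := (cot i0).
Local Notation Gam := (christoffel g).

(** Both Ric (all weights 1) and the curvature term on a diagonal tensor
    (weights its eigenvalues) are sums of this form.  The hypothesis [gamE],
    d - 1 = (dim - 2) gam for a block of size d, is what makes the fibre
    curvatures contribute equally to all blocks; it is the Einstein condition for
    the link of the cone. *)
Lemma sum_curv_warped (w : 'I_n -> R) z i j : D z ->
  (forall i j, bl i = bl j -> w i = w j) ->
  \sum_a w a * curv g i a j a z =
    (i == j)%:R * G i z *
    (if i == i0 then \sum_a w a - w i0
     else w i0 - cot z ^+ 2 * (\sum_a w a - w i0 - w i)
          + w i * (n%:R - 2) / sin (z 0 i0) ^+ 2).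
Proof.
move=> Dz wbl; have s0 : sin (z 0 i0) != 0 by rewrite gt_eqF.
have sum_split : \sum_a w a * curv g i a j a z =
    (i == j)%:R * G i z *
      \sum_a ((a != i)%:R * w a * sectional i0 bl gam i a z).
  rewrite mulr_sumr; apply: eq_bigr => a _.
  by rewrite curv_warped//; case: (i == j); case: (a != i) => /=; ring.
rewrite sum_split; congr (_ * _); rewrite /sectional.
case: (eqVneq i i0) => [->|ii] /=.
  rewrite -[X in _ - X](sum_delta_l w i0) -sumrB.
  by apply: eq_bigr => a _; case: eqP => _ /=; rewrite ?mulr0n ?mulr1n; ring.
pose r := w i / (gam (bl i) * sin (z 0 i0) ^+ 2).
rewrite (eq_bigr (fun a => (a == i0)%:R * ((1 + cot z ^+ 2) * w a)
   + (a == i)%:R * (cot z ^+ 2 * w a - r)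
   + - cot z ^+ 2 * w a + (bl a == bl i)%:R * r)).
  rewrite !big_split/= !sum_delta_l -mulr_sumr -mulr_suml.
  have -> : \sum_p (bl p == bl i)%:R = (n%:R - 2) * gam (bl i) + 1.
    rewrite -gamE// subrK [RHS]big_mkcond/=.
    by apply: eq_bigr => p _; case: eqP.
  by rewrite /r; have gi := gam0 i; field; apply/andP.
move=> a _; rewrite /r.
case: (eqVneq a i) => [->|ai].
  by rewrite (negbTE ii) eqxx /= ?mulr0n ?mulr1n; ring.
case: (eqVneq a i0) => [->|aa].
  by rewrite [bl i0 == _]eq_sym bl0 (negbTE ii) /= ?mulr0n ?mulr1n; ring.
rewrite [bl i == _]eq_sym; case: (eqVneq (bl a) (bl i)) => [e|_] /=.
  by rewrite (wbl _ _ e); ring.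
by rewrite ?mulr0n ?mulr1n; ring.
Qed.

Lemma ricci_warped z i j : D z ->
  ricci g z i j = (n%:R - 1) * ((i == j)%:R * G i z).
Proof.
move=> Dz; rewrite mxE; have s0 : sin (z 0 i0) != 0 by rewrite gt_eqF.
transitivity (\sum_a 1 * curv g i a j a z).
  by apply: eq_bigr => a _; rewrite mul1r.
rewrite (sum_curv_warped (w := fun=> 1))// sumr_const card_ord.
rewrite -/(n%:R) mulrC; congr (_ * _); case: ifP => // _.
by rewrite (inv_sin_sqr Dz); ring.
Qed.

Context (s : 'I_n -> R).
Hypothesis s0 : s i0 = 0.
Hypothesis s_sum : \sum_i s i = 0.
Hypothesis s_bl : forall i j, bl i = bl j -> s i = s j.

(** The tensor with constant eigenvalues [s] with respect to the metric; it
    vanishes in the radial direction and is trace-free, since [s i0 = 0] and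
    [s_sum] holds. *)
Definition split_tensor i j z : R := (i == j)%:R * (s i * G i z).
Local Notation S := split_tensor.

Lemma split_tensor0l j z : S i0 j z = 0.
Proof. by rewrite /S s0; ring. Qed.

(** The covariant derivative -cot (dt_i S_bj + dt_j S_bi) of the split tensor S:
    S is parallel along the fibres and along the radial lines, and its derivative
    only sees the second fundamental form of the slices. *)
Definition nabla_split b i j z : R :=
  - cot z * ((i == i0)%:R * S b j z + (j == i0)%:R * S b i z).

(** Blocks with different eigenvalues interact through the radial direction
    only, and there with the same coefficient cot for all of them. *)
Lemma log_slope_split i j z :
  lam i j z * (s j - s i) = (i == i0)%:R * cot z * s j.
Proof.
rewrite /log_slope; case: (eqVneq j i0) => [->|jj]; first by rewrite s0; ring.
case: (eqVneq i i0) => [->|ii]; first by rewrite s0 mulr1n; ring.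
by case: (eqVneq (bl i) (bl j)) => [e|_]; rewrite ?(s_bl e) mulr0n; ring.
Qed.

Lemma is_derive_split_tensor b i j z : D z ->
  is_derive z (delta_mx 0 b) (S i j)
    (nabla_split b i j z
     + (Gam j b i z * (s j * G j z) + Gam i b j z * (s i * G i z))).
Proof.
move=> Dz; have G0 p := warped_neq0 gam0 p Dz.
have h := is_derive_fun_mul (is_derive_const_fun (i == j)%:R z (delta_mx 0 b))
  (is_derive_fun_mul (is_derive_const_fun (s i) _ _)
  (is_derive_warped gam bl0 b i Dz)).
apply: is_derive_eq h _.
rewrite !christoffel_warped// /nabla_split /S.
have e1 := log_slope_split i j z; have e2 := log_slope_split j i z.
rewrite [b == j]eq_sym [b == i]eq_sym [j == i]eq_sym.
transitivity ((i == j)%:R * (s i * (2 * lam b i z * G i z))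
  + (j == b)%:R * G b z * (lam i j z * (s j - s i) - (i == i0)%:R * cot z * s j)
  + (i == b)%:R * G b z * (lam j i z * (s i - s j) - (j == i0)%:R * cot z * s i)).
  by rewrite e1 e2; ring.
case: (eqVneq i j) => [<-|ij]; case: (eqVneq i b) => [<-|ib];
  rewrite ?mulr1n ?mulr0n ?[i == b]eq_sym.
- by field; rewrite G0.
- by rewrite ?(negbTE ib) ?mulr0n; field; rewrite ?G0.
- by rewrite [j == i]eq_sym (negbTE ij) mulr0n; field; rewrite ?G0.
- by case: (eqVneq j b) => [<-|jb]; rewrite ?mulr1n ?mulr0n; field; rewrite ?G0.
Qed.


Context (phi phi1 phi2 : R -> R) (T : 'rV[R]_n -> 'M[R]_n).
Hypothesis dphi : forall t, 0 < sin t -> is_derive t 1 phi (phi1 t).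
Hypothesis dphi1 : forall t, 0 < sin t -> is_derive t 1 phi1 (phi2 t).
Hypothesis TE : forall z i j, D z -> T z i j = phi (z 0 i0) * S i j z.

Lemma sum_christoffel_split b i j z :
  \sum_p Gam p b i z * S p j z = Gam j b i z * (s j * G j z).
Proof.
rewrite -(sum_delta_l (fun p => Gam p b i z * (s p * G p z)) j).
by apply: eq_bigr => p _; rewrite /S; ring.
Qed.

Lemma split_tensor_sym i j z : S i j z = S j i z.
Proof. by rewrite /S eq_sym; case: eqP => [->|_]; rewrite ?mulr0n ?mul0r. Qed.

Definition nabla_T a i j z : R :=
  phi1 (z 0 i0) * ((a == i0)%:R * S i j z)
  + phi (z 0 i0) * nabla_split a i j z.

Lemma is_derive_radial (f : R -> R) df z b : is_derive (z 0 i0) 1 f df ->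
  is_derive z (delta_mx 0 b) (fun y => f (y 0 i0)) (df * (b == i0)%:R).
Proof.
move=> h; rewrite eq_sym.
exact: (is_derive_fun_comp (f := fun y : 'rV[R]_n => y 0 i0) h
  (is_derive_coord _ _ _)).
Qed.

Lemma nablaE a i j z : D z -> nabla g T a i j z = nabla_T a i j z.
Proof.
move=> Dz; rewrite /nabla.
have -> : partial a (fun y => T y i j) z =
    phi1 (z 0 i0) * (a == i0)%:R * S i j z + phi (z 0 i0) *
    (nabla_split a i j z
     + (Gam j a i z * (s j * G j z) + Gam i a j z * (s i * G i z))).
  apply: (partial_near (@open_regular_points _ _ i0) Dz
    (h := fun y => phi (y 0 i0) * S i j y)) => [y Dy|]; first by rewrite TE.
  apply: is_derive_fun_mul; last exact: is_derive_split_tensor.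
  by apply: is_derive_radial; exact: dphi.
rewrite (eq_bigr (fun p => phi (z 0 i0) * (Gam p a i z * S p j z)
    + phi (z 0 i0) * (Gam p a j z * S p i z))); last first.
  by move=> p _; rewrite !TE// [S i p z]split_tensor_sym; ring.
by rewrite big_split/= -!mulr_sumr !sum_christoffel_split /nabla_T; ring.
Qed.

Lemma christoffel0E b i z : D z ->
  Gam i0 b i z = - ((b == i)%:R * ((b != i0)%:R * cot z * G b z)).
Proof.
move=> Dz; rewrite christoffel_warped// warped0 divr1 /log_slope eqxx.
by case: (eqVneq b i0) => [_|_] /=; rewrite ?eqxx ?mulr0n ?mulr1n; ring.
Qed.

(** The Leibniz rule for the three-tensor phi' dt S - phi cot (dt S + S dt);
    all terms with Christoffel symbols other than those of dt recombine into
    covariant derivatives of S. *)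
Lemma nabla2E b a i j z : D z -> nabla2 g T b a i j z =
  (b == i0)%:R * (a == i0)%:R * phi2 (z 0 i0) * S i j z
  - (b == i0)%:R * (phi1 (z 0 i0) * cot z - phi (z 0 i0) * (sin (z 0 i0))^-2)
      * ((i == i0)%:R * S a j z + (j == i0)%:R * S a i z)
  + phi1 (z 0 i0) * ((a == i0)%:R * nabla_split b i j z - Gam i0 b a z * S i j z)
  + phi (z 0 i0) * cot z *
     (Gam i0 b i z * S a j z + Gam i0 b j z * S a i z
      - ((i == i0)%:R * nabla_split b a j z + (j == i0)%:R * nabla_split b a i z)).
Proof.
move=> Dz; rewrite /nabla2.
pose B := phi (z 0 i0) * cot z.
have dS p q := is_derive_split_tensor b p q Dz.
have -> : partial b (fun y => nabla g T a i j y) z =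
    (phi2 (z 0 i0) * (b == i0)%:R) * ((a == i0)%:R * S i j z)
    + phi1 (z 0 i0) * ((a == i0)%:R * (nabla_split b i j z
     + (Gam j b i z * (s j * G j z) + Gam i b j z * (s i * G i z))))
    - (b == i0)%:R * (phi1 (z 0 i0) * cot z - phi (z 0 i0) * (sin (z 0 i0))^-2)
      * ((i == i0)%:R * S a j z + (j == i0)%:R * S a i z)
    - B * ((i == i0)%:R * (nabla_split b a j z
        + (Gam j b a z * (s j * G j z) + Gam a b j z * (s a * G a z)))
      + (j == i0)%:R * (nabla_split b a i z
        + (Gam i b a z * (s i * G i z) + Gam a b i z * (s a * G a z)))).
  apply: (partial_near (@open_regular_points _ _ i0) Dz (h := nabla_T a i j)) => [y Dy|].
    exact: nablaE.
  have dp := is_derive_radial b (dphi Dz).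
  have dp1 := is_derive_radial b (dphi1 Dz).
  have dc := is_derive_cot b Dz.
  have h := is_derive_fun_add
    (is_derive_fun_mul dp1
      (is_derive_fun_mul (is_derive_const_fun (a == i0)%:R z _) (dS i j)))
    (is_derive_fun_mul dp
      (is_derive_fun_mul (is_derive_fun_mul (is_derive_const_fun (-1) z _) dc)
       (is_derive_fun_add
        (is_derive_fun_mul (is_derive_const_fun (i == i0)%:R z _) (dS a j))
        (is_derive_fun_mul (is_derive_const_fun (j == i0)%:R z _) (dS a i))))).
  have -> : nabla_T a i j = fun y =>
     phi1 (y 0 i0) * ((a == i0)%:R * S i j y) + phi (y 0 i0) *
     (-1 * cot y * ((i == i0)%:R * S a j y + (j == i0)%:R * S a i y)).
    by apply/funext => y; rewrite /nabla_T /nabla_split mulN1r.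
  apply: is_derive_eq h _; rewrite /B [i0 == b]eq_sym.
  by move: (Gam j b i z) (Gam i b j z) (Gam j b a z) (Gam a b j z) (Gam i b a z)
  (Gam a b i z) => *; ring.
rewrite (eq_bigr (fun p =>
    (p == i0)%:R * (Gam p b a z * (phi1 (z 0 i0) * S i j z)
      - B * (Gam p b i z * S a j z + Gam p b j z * S a i z))
    + - (B * (i == i0)%:R) * (Gam p b a z * S p j z)
    + - (B * (j == i0)%:R) * (Gam p b a z * S p i z)
    + (phi1 (z 0 i0) * (a == i0)%:R) * (Gam p b i z * S p j z)
    + - (B * (j == i0)%:R) * (Gam p b i z * S p a z)
    + (phi1 (z 0 i0) * (a == i0)%:R) * (Gam p b j z * S p i z)
    + - (B * (i == i0)%:R) * (Gam p b j z * S p a z))); last first.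
  move=> p _; rewrite !nablaE// /nabla_T /nabla_split /B.
  rewrite [S a p z]split_tensor_sym [S i p z]split_tensor_sym.
  by move: (Gam p b a z) (Gam p b i z) (Gam p b j z) => *; ring.
rewrite !big_split/= sum_delta_l -!mulr_sumr !sum_christoffel_split /B.
by move: (Gam j b i z) (Gam i b j z) (Gam j b a z) (Gam a b j z) (Gam i b a z)
  (Gam a b i z)
  (Gam i0 b a z) (Gam i0 b i z) (Gam i0 b j z) => *; ring.
Qed.

Lemma contract_diag_metric (F : 'I_n -> 'I_n -> R) z : D z ->
  \sum_a \sum_b invmx (g z) a b * F a b = \sum_a (G a z)^-1 * F a a.
Proof.
move=> Dz; rewrite invmx_diag_metric; last by move=> i; exact: warped_neq0.
apply: eq_bigr => a _.
under eq_bigr do rewrite diag_metricE -mulrA.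
exact: sum_delta_r.
Qed.

Lemma sum_split_trace z : D z -> \sum_a (G a z)^-1 * S a a z = 0.
Proof.
move=> Dz; rewrite -[RHS]s_sum; apply: eq_bigr => a _.
by rewrite /S eqxx mul1r [s a * _]mulrC mulKf// warped_neq0.
Qed.

Lemma metric_trace_warped z : D z -> metric_trace g T z = 0.
Proof.
move=> Dz; rewrite /metric_trace contract_diag_metric//.
under eq_bigr do rewrite TE// mulrCA.
by rewrite -mulr_sumr sum_split_trace// mulr0.
Qed.

Lemma sum_nabla_split j z : D z ->
  \sum_a (G a z)^-1 * nabla_split a a j z = 0.
Proof.
move=> Dz.
rewrite (eq_bigr (fun a => (a == i0)%:R * (- cot z * (G a z)^-1 * S a j z)
  + - cot z * (j == i0)%:R * ((G a z)^-1 * S a a z))); last first.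
  by move=> a _; rewrite /nabla_split; ring.
rewrite big_split/= sum_delta_l -mulr_sumr sum_split_trace// split_tensor0l.
by rewrite !mulr0 addr0.
Qed.

(** The divergence of phi S is -phi' S(dt, .) + phi cot (tr S) dt, up to sign,
    and both terms vanish. *)
Lemma divergence_warped j z : D z -> divergence g T j z = 0.
Proof.
move=> Dz; rewrite /divergence contract_diag_metric//.
rewrite (eq_bigr (fun a =>
    (a == i0)%:R * (phi1 (z 0 i0) * (G a z)^-1 * S a j z)
    + phi (z 0 i0) * ((G a z)^-1 * nabla_split a a j z))); last first.
  by move=> a _; rewrite nablaE// /nabla_T; ring.
rewrite big_split/= sum_delta_l -mulr_sumr sum_nabla_split// split_tensor0l.
by rewrite !mulr0 addr0 oppr0.
Qed.

(** The term -(n - 1) cot phi' comes from the mean curvature of the slices, and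
    the term 2 cot^2 phi from differentiating both factors dt of the covariant
    derivative of S, since the Hessian of t is cot times the metric of the slices. *)
Lemma rough_laplacian_warped i j z : D z ->
  rough_laplacian g T z i j =
  (- phi2 (z 0 i0) - (n%:R - 1) * cot z * phi1 (z 0 i0)
   + 2 * cot z ^+ 2 * phi (z 0 i0)) * S i j z.
Proof.
move=> Dz; rewrite mxE contract_diag_metric//.
have Gn0 p := warped_neq0 gam0 p Dz.
have sn0 : sin (z 0 i0) != 0 by rewrite gt_eqF.
rewrite (eq_bigr (fun a =>
    (a == i0)%:R * ((G a z)^-1 *
      (phi2 (z 0 i0) * S i j z
       - (phi1 (z 0 i0) * cot z - phi (z 0 i0) * (sin (z 0 i0))^-2)
         * ((i == i0)%:R * S a j z + (j == i0)%:R * S a i z)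
       + phi1 (z 0 i0) * nabla_split a i j z
       - phi1 (z 0 i0) * cot z * G a z * S i j z))
    + phi1 (z 0 i0) * cot z * S i j z
    - phi (z 0 i0) * cot z * (i == i0)%:R * ((G a z)^-1 * nabla_split a a j z)
    - phi (z 0 i0) * cot z * (j == i0)%:R * ((G a z)^-1 * nabla_split a a i z)
    + - phi (z 0 i0) * cot z ^+ 2 *
       ((a == i)%:R * ((a != i0)%:R * S a j z)
        + (a == j)%:R * ((a != i0)%:R * S a i z)))); last first.
  move=> a _; rewrite nabla2E// !christoffel0E// eqxx.
  by case: (eqVneq a i0) => [->|aa]; rewrite /= ?mulr0n ?mulr1n ?warped0; field; rewrite ?Gn0 ?sn0.
rewrite !big_split/= !sumrN -!mulr_sumr !big_split/= !sum_delta_l !sum_nabla_split//.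
rewrite sumr_const card_ord !split_tensor0l /nabla_split !split_tensor0l.
rewrite warped0 [S j i z]split_tensor_sym.
have e p q : (p != i0)%:R * S p q z = S p q z.
  by case: (eqVneq p i0) => [->|_]; rewrite ?split_tensor0l ?mulr0 ?mul1r.
have -> : (j != i0)%:R * S i j z = S i j z by rewrite split_tensor_sym e.
by rewrite e invr1 -mulr_natr /S; ring.
Qed.

Definition lichnerowicz_radial (t : R) : R :=
  - phi2 t - (n%:R - 1) * (cos t / sin t) * phi1 t
  + (2 * (n%:R - 1) - 2 * (n%:R - 2) / sin t ^+ 2) * phi t.

(** Ric is (n - 1) g and the curvature term acts on S by
    cot^2 + (n - 2) / sin^2, so that the two cot^2 terms cancel. *)
Lemma lichnerowicz_warped i j z : D z ->
  lichnerowicz g T z i j = lichnerowicz_radial (z 0 i0) * S i j z.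
Proof.
move=> Dz; have Gn0 p := warped_neq0 gam0 p Dz.
have invE p q : invmx (g z) p q = (p == q)%:R * (G p z)^-1.
  rewrite invmx_diag_metric; last by move=> i'; exact: warped_neq0.
  exact: diag_metricE.
have ricM : ricci g z *m invmx (g z) = (n%:R - 1)%:M.
  apply/matrixP => p q; rewrite !mxE.
  under eq_bigr do rewrite ricci_warped// invE.
  rewrite (eq_bigr (fun r => (p == r)%:R *
    ((n%:R - 1) * G p z * ((r == q)%:R * (G r z)^-1)))); last first.
    by move=> r _; ring.
  by rewrite sum_delta_r -mulr_natr; case: (p == q); rewrite ?mulr0n; field.
have ricM' : invmx (g z) *m ricci g z = (n%:R - 1)%:M.
  apply/matrixP => p q; rewrite !mxE.
  under eq_bigr do rewrite ricci_warped// invE.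
  rewrite (eq_bigr (fun r => (p == r)%:R *
    ((n%:R - 1) * (G p z)^-1 * ((r == q)%:R * G r z)))); last first.
    by move=> r _; ring.
  by rewrite sum_delta_r -mulr_natr; case: (p == q); rewrite ?mulr0n; field.
have ringE : ring_curv g T z i j =
    (cot z ^+ 2 + (n%:R - 2) / sin (z 0 i0) ^+ 2) * phi (z 0 i0) * S i j z.
  rewrite mxE contract_diag_metric//.
  rewrite (eq_bigr (fun a => phi (z 0 i0) * (s a * curv g i a j a z))).
    rewrite -mulr_sumr (sum_curv_warped _ _ Dz s_bl) s_sum s0 /S.
    by case: ifP => [/eqP->|_]; rewrite ?s0; ring.
  move=> a _; rewrite (eq_bigr (fun p => (p == a)%:R *
    (curv g i a j p z * (phi (z 0 i0) * (s p * G p z))))).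
    by rewrite sum_delta_l; move: (curv g i a j a z) (Gn0 a) => c Ga0; field.
  by move=> p _; rewrite TE// /S; move: (curv g i a j p z) => c; ring.
have entries (A B C E : 'M[R]_n) :
    (A + (B + C - 2 *: E)) i j = A i j + (B i j + C i j - 2 * E i j).
  by rewrite !mxE.
rewrite /lichnerowicz entries rough_laplacian_warped// ringE ricM -mulmxA ricM' mul_scalar_mx mul_mx_scalar !mxE TE//.
rewrite /lichnerowicz_radial -/(cot z) !(inv_sin_sqr Dz).
by ring.
Qed.

Lemma tensor_inner_warped z : D z ->
  tensor_inner g (lichnerowicz g T) T z =
  lichnerowicz_radial (z 0 i0) * phi (z 0 i0) * \sum_i s i ^+ 2.
Proof.
move=> Dz; have Gn0 p := warped_neq0 gam0 p Dz.
pose Sm (c : R) := diag_metric (fun p y => c * s p * G p y) z.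
have diagE (f : R) (F : 'M[R]_n) : (forall p q, F p q = f * S p q z) -> F = Sm f.
  by move=> FE; apply/matrixP => p q; rewrite FE diag_metricE /S; ring.
rewrite /tensor_inner (diagE _ _ (fun p q => lichnerowicz_warped p q Dz)).
rewrite (diagE (phi (z 0 i0)) (T z)); last by move=> p q; exact: TE.
rewrite invmx_diag_metric// /Sm /diag_metric tr_diag_mx !mulmx_diag mxtrace_diag.
rewrite mulr_sumr; apply: eq_bigr => p _; rewrite !mxE; field.
exact: Gn0.
Qed.

End WarpedTT.

(** * Stereographic coordinates *)

Lemma dotpE {R : realType} m (x y : 'rV[R]_m) : dotp x y = \sum_j x 0 j * y 0 j.
Proof. by rewrite /dotp mxE; apply: eq_bigr => j _; rewrite mxE. Qed.

Lemma dotp_ge0 {R : realType} m (x : 'rV[R]_m) : 0 <= dotp x x.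
Proof. by rewrite dotpE sumr_ge0// => j _; rewrite -expr2 sqr_ge0. Qed.

Section Jacobian.
Context {R : realType} {m n : nat}.
Implicit Types (F : 'rV[R]_m -> 'rV[R]_n) (z : 'rV[R]_m).

(** Reduces every Jacobian below to partial derivatives of coordinate functions. *)
Lemma jacobianE F z a j :
  (forall j, differentiable (fun y => F y 0 j) z) ->
  'J F z a j = partial a (fun y => F y 0 j) z.
Proof.
move=> dF; have dFz : differentiable F z.
  by apply: differentiable_mx => i' j'; rewrite (ord1 i'); exact: dF.
have -> : 'J F z a j = ('D_(delta_mx 0 a) F z) 0 j.
  by rewrite deriveEjacobian// -rowE [RHS]mxE.
by rewrite derive_mx; [rewrite mxE|exact: diff_derivable].
Qed.

Lemma pullback_euclidean_entries (x : 'rV[R]_m -> 'rV[R]_n) z a a' :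
  (forall j, differentiable (fun y => x y 0 j) z) ->
  ('J x z *m ('J x z)^T) a a' =
  \sum_j partial a (fun y => x y 0 j) z * partial a' (fun y => x y 0 j) z.
Proof.
by move=> dx; rewrite mxE; apply: eq_bigr => j _; rewrite [X in _ * X]mxE !jacobianE.
Qed.

End Jacobian.

Section Stereographic.
Context {R : realType} {m n : nat} (e : 'I_n -> 'I_m) (b : bool).
Hypothesis e_inj : injective e.
Implicit Types (z y : 'rV[R]_m) (a : 'I_m).

(** Stereographic coordinates on a subset of the coordinates of a larger space,
    given by an injection [e], so that both sphere factors are treated at once. *)
Definition stereo_coord z : 'rV[R]_(1 + n) := stereo b (\row_j z 0 (e j)).

Let S z := \sum_j z 0 (e j) ^+ 2.
Let rho z := 2 / (1 + S z).

Let S_ge0 z : 0 < 1 + S z.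
Proof. by rewrite ltr_pwDl// sumr_ge0// => j _; rewrite sqr_ge0. Qed.

Let dotpS z : dotp (\row_j z 0 (e j)) (\row_j z 0 (e j)) = S z.
Proof. by rewrite dotpE; apply: eq_bigr => j _; rewrite !mxE -expr2. Qed.

Let entry0 z j : stereo_coord z 0 (lshift n j) = (-1) ^+ b * (1 - rho z).
Proof.
rewrite /stereo_coord /stereo dotpS mxE row_mxEl mxE ord1 eqxx mulr1n /rho.
by have := S_ge0 z => /lt0r_neq0 h; field.
Qed.

Let entry1 z j : stereo_coord z 0 (rshift 1 j) = rho z * z 0 (e j).
Proof.
rewrite /stereo_coord /stereo dotpS mxE row_mxEr !mxE /rho.
by rewrite mulrA [_^-1 * 2]mulrC.
Qed.

Lemma stereo_coord_sphere z : dotp (stereo_coord z) (stereo_coord z) = 1.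
Proof.
rewrite dotpE big_split_ord/= big_ord1 entry0.
under eq_bigr do rewrite entry1.
rewrite (eq_bigr (fun j => rho z ^+ 2 * z 0 (e j) ^+ 2)); last first.
  by move=> j _; ring.
rewrite -mulr_sumr -/(S z) /rho.
have sg : (-1) ^+ b * (-1) ^+ b = 1 :> R by rewrite -signr_addb addbb.
rewrite mulrACA sg; have /lt0r_neq0 h := S_ge0 z; by field.
Qed.

Let smooth_rho : smooth_fun setT rho.
Proof.
apply: smooth_mul; first exact: smooth_cst.
apply: smooth_inv; last by move=> p _; rewrite gt_eqF.
apply: smooth_add; first exact: smooth_cst.
apply: smooth_fun_sum => j; under eq_fun do rewrite expr2.
by apply: smooth_mul; exact: smooth_coord.
Qed.

Lemma smooth_stereo_coord j : smooth_fun setT (fun z => stereo_coord z 0 j).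
Proof.
case: (splitP j) => j' ej.
  have -> : j = lshift n j' by apply: val_inj.
  under eq_fun do rewrite entry0 -[- rho _]mulN1r.
  apply: smooth_mul; first exact: smooth_cst.
  apply: smooth_add; first exact: smooth_cst.
  by apply: smooth_mul => //; exact: smooth_cst.
have -> : j = rshift 1 j' by apply: val_inj.
under eq_fun do rewrite entry1.
by apply: smooth_mul => //; exact: smooth_coord.
Qed.

Lemma differentiable_stereo_coord z j :
  differentiable (fun y => stereo_coord y 0 j) z.
Proof. exact: smooth_fun_differentiable (smooth_stereo_coord j) _. Qed.

Let w a z := \sum_j (e j == a)%:R * z 0 (e j).

Let is_derive_rho z a : is_derive z (delta_mx 0 a) rho (- (rho z ^+ 2 * w a z)).
Proof.
have dS : is_derive z (delta_mx 0 a) (fun y => 1 + S y) (0 + 2 * w a z).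
  apply: is_derive_fun_add (is_derive_const_fun _ _ _) _.
  rewrite /S /w mulr_sumr; apply: is_derive_fun_sum => j.
  under eq_fun do rewrite expr2.
  apply: is_derive_eq (is_derive_fun_mul (is_derive_coord (e j) a z)
    (is_derive_coord (e j) a z)) _.
  by ring.
have /lt0r_neq0 h := S_ge0 z.
have dr := is_derive_fun_mul (is_derive_const_fun 2 _ _)
  (@is_derive_fun_inv _ _ (fun y => 1 + S y) _ _ _ h dS).
by apply: is_derive_eq dr _; rewrite /rho; field.
Qed.

(** Inverse stereographic projection is conformal: the pole component of the
    derivative exactly compensates the terms proportional to the position. *)
Lemma pullback_stereo_coord z a a' :
  ('J stereo_coord z *m ('J stereo_coord z)^T) a a' =
  (a == a')%:R * (a \in codom e)%:R * (2 / (1 + \sum_j z 0 (e j) ^+ 2)) ^+ 2.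
Proof.
rewrite pullback_euclidean_entries; last first.
  by move=> j; exact: differentiable_stereo_coord.
have d0 c j : partial c (fun y => stereo_coord y 0 (lshift n j)) z =
    (-1) ^+ b * (rho z ^+ 2 * w c z).
  apply: partialE; under eq_fun do rewrite entry0 -[- rho _]mulN1r.
  apply: is_derive_eq (is_derive_fun_mul (is_derive_const_fun _ _ _)
    (is_derive_fun_add (is_derive_const_fun 1 _ _)
     (is_derive_fun_mul (is_derive_const_fun (-1) _ _) (is_derive_rho z c)))) _.
  by ring.
have d1 c j : partial c (fun y => stereo_coord y 0 (rshift 1 j)) z =
    rho z * (e j == c)%:R - rho z ^+ 2 * w c z * z 0 (e j).
  apply: partialE; under eq_fun do rewrite entry1.
  apply: is_derive_eq (is_derive_fun_mul (is_derive_rho z c)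
    (is_derive_coord _ _ _)) _.
  by ring.
rewrite big_split_ord/= big_ord1 !d0; under eq_bigr do rewrite !d1.
pose dd : R := \sum_j (e j == a)%:R * (e j == a')%:R.
have -> : (a == a')%:R * (a \in codom e)%:R = dd.
  rewrite /dd; case: (boolP (a \in codom e)) => [/codomP[j0 ->]|ane].
    rewrite (bigD1 j0)//= eqxx big1 ?addr0 ?mulr1 ?mul1r// => j jj0.
    by rewrite (inj_eq e_inj) (negbTE jj0) mul0r.
  rewrite mulr0 big1// => j _; case: eqP => [ej|_]; last by rewrite mul0r.
  by move: ane; rewrite -ej codom_f.
rewrite (eq_bigr (fun j => rho z ^+ 2 * ((e j == a)%:R * (e j == a')%:R)
   - rho z ^+ 3 * w a' z * ((e j == a)%:R * z 0 (e j))
   - rho z ^+ 3 * w a z * ((e j == a')%:R * z 0 (e j))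
   + rho z ^+ 4 * w a z * w a' z * z 0 (e j) ^+ 2)); last first.
  by move=> j _; ring.
rewrite !big_split/= !sumrN -!mulr_sumr -/dd -!/(w _ _) -/(S z) -/(rho z).
have sg : (-1) ^+ b * (-1) ^+ b = 1 :> R by rewrite -signr_addb addbb.
rewrite mulrACA sg.
have rS : rho z * S z = 2 - rho z.
  by rewrite /rho; have /lt0r_neq0 h := S_ge0 z; field.
transitivity (rho z ^+ 4 * w a z * w a' z + rho z ^+ 2 * dd
  - 2 * rho z ^+ 3 * w a z * w a' z
  + rho z ^+ 3 * w a z * w a' z * (rho z * S z)); first by ring.
by rewrite rS; ring.
Qed.

End Stereographic.

(** * The cone metric in coordinates *)

Section ConeCoordinates.
Context {R : realType} (k l : nat).
Local Notation n := ((1 + k) + l)%N.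
Implicit Types (z : 'rV[R]_n).

Definition radial_index : 'I_n := lshift l (lshift k ord0).
Definition first_index (j : 'I_k) : 'I_n := lshift l (rshift 1 j).
Definition second_index (j : 'I_l) : 'I_n := rshift (1 + k) j.
Definition block (i : 'I_n) : nat :=
  match fintype.split i with
  | inl j => match fintype.split j with inl _ => 0%N | inr _ => 1%N end
  | inr _ => 2%N
  end.
Local Notation i0 := radial_index.

Definition cone_factor (d : nat) : R := (d%:R - 1) / (k%:R + l%:R - 1).
Definition block_factor (c : nat) : R :=
  if c == 1%N then cone_factor k else if c == 2%N then cone_factor l else 1.

Lemma block0 : block i0 = 0%N.
Proof. by rewrite /block /i0 (unsplitK (inl _)) (unsplitK (inl _)). Qed.

Lemma block1 j : block (first_index j) = 1%N.
Proof. by rewrite /block (unsplitK (inl _)) (unsplitK (inr _)). Qed.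

Lemma block2 j : block (second_index j) = 2%N.
Proof. by rewrite /block (unsplitK (inr _)). Qed.

(** The case analysis on coordinate indices that replaces nested splittings of
    the index interval. *)
Variant index_spec : 'I_n -> Type :=
| RadialIndex : index_spec i0
| FirstIndex j : index_spec (first_index j)
| SecondIndex j : index_spec (second_index j).

Lemma indexP i : index_spec i.
Proof.
rewrite -(splitK i); case: (fintype.split i) => [j|j] /=; last exact: SecondIndex.
rewrite -(splitK j); case: (fintype.split j) => [j'|j'] /=; last exact: FirstIndex.
by rewrite (ord1 j'); exact: RadialIndex.
Qed.

Lemma block_radial i : (block i == block i0) = (i == i0).
Proof.
case: (indexP i) => [|j|j]; rewrite ?eqxx// block0 ?block1 ?block2.
- by apply/esym/eqP => /(congr1 block); rewrite block0 block1.
- by apply/esym/eqP => /(congr1 block); rewrite block0 block2.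
Qed.

Lemma big_index (F : 'I_n -> R) :
  \sum_i F i = F i0 + \sum_j F (first_index j) + \sum_j F (second_index j).
Proof. by rewrite big_split_ord/= big_split_ord/= big_ord1. Qed.

Lemma sum_block1 (F : 'I_n -> R) :
  \sum_(p | block p == 1%N) F p = \sum_j F (first_index j).
Proof.
rewrite big_mkcond big_index/= block0/= add0r.
under eq_bigr do rewrite block1/=.
by rewrite [X in _ + X]big1 ?addr0// => j _; rewrite block2.
Qed.

Lemma sum_block2 (F : 'I_n -> R) :
  \sum_(p | block p == 2%N) F p = \sum_j F (second_index j).
Proof.
rewrite big_mkcond big_index/= block0/= add0r.
rewrite big1 ?add0r; last by move=> j _; rewrite block1.
by under eq_bigr do rewrite block2/=.
Qed.

Lemma first_index_inj : injective first_index.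
Proof. by move=> i j /lshift_inj/rshift_inj. Qed.

Lemma second_index_inj : injective second_index.
Proof. by move=> i j /rshift_inj. Qed.

Lemma codom_first_index i : (i \in codom first_index) = (block i == 1%N).
Proof.
apply/codomP/eqP => [[j ->]|]; first exact: block1.
by case: (indexP i) => [|j|j]; rewrite ?block0 ?block2//; exists j.
Qed.

Lemma codom_second_index i : (i \in codom second_index) = (block i == 2%N).
Proof.
apply/codomP/eqP => [[j ->]|]; first exact: block2.
by case: (indexP i) => [|j|j]; rewrite ?block0 ?block1//; exists j.
Qed.

Lemma coord_tE z : coord_t z 0 0 = z 0 i0.
Proof. by rewrite !mxE; congr (z _ _); apply: val_inj. Qed.

Lemma coord_xE b : coord_x b = stereo_coord (R := R) first_index b.
Proof.
by apply/funext => z; congr stereo; apply/rowP => j; rewrite !mxE.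
Qed.

Lemma coord_yE b : coord_y b = stereo_coord (R := R) second_index b.
Proof.
by apply/funext => z; congr stereo; apply/rowP => j; rewrite !mxE.
Qed.

Lemma pullback_coord_t z a a' :
  pullback_euclidean (@coord_t R k l) z a a' = (a == a')%:R * (a == i0)%:R.
Proof.
have tE : (fun y : 'rV[R]_n => @coord_t R k l y 0 0) = (fun y => y 0 i0).
  by apply/funext => y; rewrite coord_tE.
have d j : differentiable (fun y : 'rV[R]_n => @coord_t R k l y 0 j) z.
  by rewrite (ord1 j) tE; exact: differentiable_coord.
rewrite /pullback_euclidean pullback_euclidean_entries// big_ord1 tE.
rewrite !(partialE (is_derive_coord _ _ _)) [i0 == a]eq_sym [i0 == a']eq_sym.
case: (eqVneq a i0) => [->|_]; rewrite ?mulr0 ?mul0r ?mulr1 ?mul1r// eq_sym.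
by [].
Qed.

Lemma pullback_coord_x b z a a' :
  pullback_euclidean (coord_x b) z a a' =
  (a == a')%:R * (block a == 1%N)%:R * conformal block 1 z ^+ 2.
Proof.
rewrite coord_xE /pullback_euclidean pullback_stereo_coord; last first.
  exact: first_index_inj.
by rewrite codom_first_index /conformal sum_block1.
Qed.

Lemma pullback_coord_y b z a a' :
  pullback_euclidean (coord_y b) z a a' =
  (a == a')%:R * (block a == 2%N)%:R * conformal block 2 z ^+ 2.
Proof.
rewrite coord_yE /pullback_euclidean pullback_stereo_coord; last first.
  exact: second_index_inj.
by rewrite codom_second_index /conformal sum_block2.
Qed.

Hypotheses (k2 : (2 <= k)%N) (l2 : (2 <= l)%N).

Lemma cone_denom_gt0 : 0 < k%:R + l%:R - 1 :> R.
Proof.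
have : (2 : R) <= k%:R by rewrite (ler_nat R 2).
have : (2 : R) <= l%:R by rewrite (ler_nat R 2).
lra.
Qed.

Lemma cone_factor_gt0 d : (2 <= d)%N -> 0 < cone_factor d.
Proof.
move=> d2; rewrite divr_gt0 ?cone_denom_gt0//.
by rewrite subr_gt0 (ltr_nat R 1).
Qed.

Lemma block_factor_gt0 c : 0 < block_factor c.
Proof.
rewrite /block_factor; case: ifP => _; first exact: cone_factor_gt0.
by case: ifP => _; [exact: cone_factor_gt0|exact: ltr01].
Qed.

(** The Einstein condition: the warping constants are those for which the two
    factors of the link have the same Ricci curvature. *)
Lemma block_factorE i : i != i0 ->
  \sum_(p | block p == block i) 1 - 1 = (n%:R - 2) * block_factor (block i).
Proof.
have cd := lt0r_neq0 cone_denom_gt0.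
have nE : n%:R - 2 = k%:R + l%:R - 1 :> R by rewrite !natrD; ring.
case: (indexP i) => [|j|j]; rewrite ?eqxx// => _; rewrite nE.
- rewrite block1 sum_block1 /block_factor/= /cone_factor sumr_const card_ord.
  by rewrite mulrC divfK.
- rewrite block2 sum_block2 /block_factor/= /cone_factor sumr_const card_ord.
  by rewrite mulrC divfK.
Qed.

Lemma cone_metricE b c :
  cone_metric b c = diag_metric (warped i0 block block_factor).
Proof.
apply/funext => z; apply/matrixP => a a'.
have entries (A B C : 'M[R]_n) (u v : R) :
    (A + u *: B + v *: C) a a' = A a a' + u * B a a' + v * C a a'.
  by rewrite !mxE.
rewrite /cone_metric entries pullback_coord_t pullback_coord_x pullback_coord_y.
rewrite diag_metricE coord_tE /f_c /h_c ![(Num.sqrt _ * _) ^+ 2]exprMn.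
rewrite !sqr_sqrtr ?(ltW (cone_factor_gt0 _))// -/(cone_factor k) -/(cone_factor l).
rewrite /warped.
case: (indexP a) => [|j|j].
- by rewrite eqxx block0/= ?mulr0n ?mulr1n; ring.
- rewrite -block_radial block0 block1/= /block_factor/= ?mulr0n ?mulr1n; ring.
- rewrite -block_radial block0 block2/= /block_factor/= ?mulr0n ?mulr1n; ring.
Qed.

(** The eigenvalues of g^k / k - g^l / l rescaled by the warping functions:
    they add up to 0 over all indices. *)
Definition split_weight (i : 'I_n) : R :=
  if block i == 1%N then k%:R^-1 else if block i == 2%N then - l%:R^-1 else 0.

Lemma split_weight0 : split_weight i0 = 0.
Proof. by rewrite /split_weight block0. Qed.

Lemma sum_split_weight : \sum_i split_weight i = 0.
Proof.
rewrite big_index split_weight0 add0r.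
under eq_bigr do rewrite /split_weight block1/=.
under [X in _ + X]eq_bigr do rewrite /split_weight block2/=.
rewrite !sumr_const !card_ord mulNrn -[X in X - _]mulr_natr -[X in _ - X]mulr_natr.
have kn0 : k%:R != 0 :> R by rewrite pnatr_eq0 -lt0n (leq_trans _ k2).
have ln0 : l%:R != 0 :> R by rewrite pnatr_eq0 -lt0n (leq_trans _ l2).
by rewrite !mulVf// subrr.
Qed.

Lemma sum_split_weight_sqr : 0 < \sum_i split_weight i ^+ 2.
Proof.
rewrite big_index split_weight0 expr0n/= add0r.
under eq_bigr do rewrite /split_weight block1/=.
under [X in _ + X]eq_bigr do rewrite /split_weight block2/=.
rewrite !sumr_const !card_ord ltr_pwDl//.
  by rewrite pmulrn_lgt0 ?(leq_trans _ k2)// exprn_gt0// invr_gt0 ltr0n (leq_trans _ k2).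
by rewrite mulrn_wge0// sqr_ge0.
Qed.

Lemma split_weight_block i j : block i = block j -> split_weight i = split_weight j.
Proof. by rewrite /split_weight => ->. Qed.

End ConeCoordinates.

(** * Tensor fields on the closed manifold *)

Lemma dotpZ {R : realType} m (c : R) (x : 'rV[R]_m) : dotp (c *: x) (c *: x) = c ^+ 2 * dotp x x.
Proof. by rewrite /dotp linearZ/= -scalemxAl -scalemxAr !mxE mulrA. Qed.

Section SphereTensor.
Context {R : realType} {d : nat}.
Implicit Types (x : 'rV[R]_d).

(** The round metric of the unit sphere pulled back to the complement of the
    origin by x |-> x / |x|.  It annihilates the radial direction, as an extension
    by zero of a tensor on the sphere must. *)
Definition sphere_tensor x : 'M[R]_d :=
  (dotp x x)^-1 *: (1%:M - (dotp x x)^-1 *: (x^T *m x)).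

Lemma sphere_tensor_sym x : (sphere_tensor x)^T = sphere_tensor x.
Proof.
rewrite /sphere_tensor linearZ/= raddfB/= linearZ/=.
by rewrite trmx_mul trmxK trmx1.
Qed.

Lemma dotpM x : x *m x^T = (dotp x x)%:M.
Proof. by rewrite /dotp [LHS]mx11_scalar. Qed.

Lemma mul_sphere_tensor x : x *m sphere_tensor x = 0.
Proof.
rewrite /sphere_tensor -scalemxAr mulmxBr mulmx1 -scalemxAr mulmxA dotpM.
rewrite mul_scalar_mx scalerA; case: (eqVneq (dotp x x) 0) => [->|x0].
  by rewrite invr0 scale0r.
by rewrite mulVf// scale1r subrr scaler0.
Qed.

Lemma sphere_tensor_mul x : sphere_tensor x *m x^T = 0.
Proof. by rewrite -[LHS]trmxK trmx_mul trmxK sphere_tensor_sym mul_sphere_tensor trmx0. Qed.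

(** The tensor is homogeneous of degree -2 and annihilates the position, so
    neither the length of the vector nor its variation matters, and only the
    derivative [A] of the unit vector is left. *)
Lemma sphere_tensor_congruence x (c : R) m (r : 'cV[R]_m) (A : 'M[R]_(m, d)) :
  dotp x x = 1 -> c != 0 -> A *m x^T = 0 ->
  (r *m x + c *: A) *m sphere_tensor (c *: x) *m (r *m x + c *: A)^T = A *m A^T.
Proof.
move=> xx c0 Ax; have xA : x *m A^T = 0.
  by rewrite -[LHS]trmxK trmx_mul trmxK Ax trmx0.
have xP : x *m sphere_tensor (c *: x) = 0.
  have := mul_sphere_tensor (c *: x); rewrite -scalemxAl => /eqP.
  by rewrite scaler_eq0 (negbTE c0) => /eqP.
have Px : sphere_tensor (c *: x) *m x^T = 0.
  by rewrite -[LHS]trmxK trmx_mul trmxK sphere_tensor_sym xP trmx0.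
have Acx : A *m (c *: x)^T = 0 by rewrite linearZ/= -scalemxAr Ax scaler0.
have AP : A *m sphere_tensor (c *: x) = c^-2 *: A.
  rewrite /sphere_tensor dotpZ xx mulr1 -scalemxAr mulmxBr mulmx1 -scalemxAr.
  by rewrite mulmxA Acx mul0mx scaler0 subr0.
rewrite mulmxDl -mulmxA xP mulmx0 add0r linearD/= mulmxDr trmx_mul.
rewrite -scalemxAl AP scalerA mulmxA -scalemxAl Ax scaler0 mul0mx add0r.
rewrite linearZ/= -scalemxAl -scalemxAr scalerA.
by rewrite [X in X *: _](_ : _ = 1) ?scale1r//; field.
Qed.

End SphereTensor.

Section Model.
Context {R : realType} (M : model) (k l : nat).
Local Notation N := (ambient_dim M k l).

Definition first_projection : 'M[R]_(N, 1 + k) :=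
  match M return 'M[R]_(ambient_dim M k l, 1 + k) with
  | SphereProduct => col_mx (col_mx 1%:M 0) 0
  | Sphere => col_mx 1%:M 0
  end.

Definition second_projection : 'M[R]_(N, 1 + l) :=
  match M return 'M[R]_(ambient_dim M k l, 1 + l) with
  | SphereProduct => col_mx 0 1%:M
  | Sphere => col_mx 0 1%:M
  end.

(** A polynomial on the ambient space whose value on the orbit of parameter t is
    cos t.  Writing radial functions through it gives smooth fields on M. *)
Definition height : 'rV[R]_N -> R :=
  match M return 'rV[R]_(ambient_dim M k l) -> R with
  | SphereProduct => fun p => rsubmx (lsubmx p) 0 0
  | Sphere => fun p => dotp (rsubmx p) (rsubmx p) - dotp (lsubmx p) (lsubmx p)
  end.

Definition first_radius (t : R) : R :=
  match M with SphereProduct => sin t | Sphere => sin (t / 2) end.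

Definition second_radius (t : R) : R :=
  match M with SphereProduct => 1 | Sphere => cos (t / 2) end.

Local Notation Pi1 := first_projection.
Local Notation Pi2 := second_projection.

Lemma orbit_map_first t x y : orbit_map M t x y *m Pi1 = first_radius t *: x.
Proof.
rewrite /orbit_map /first_projection /first_radius; case: M.
  by rewrite !mul_row_col mulmx1 !mulmx0 !addr0.
by rewrite !mul_row_col mulmx1 !mulmx0 !addr0.
Qed.

Lemma orbit_map_second t x y : orbit_map M t x y *m Pi2 = second_radius t *: y.
Proof.
rewrite /orbit_map /second_projection /second_radius; case: M.
  by rewrite mul_row_col mulmx1 !mulmx0 add0r scale1r.
by rewrite mul_row_col mulmx1 !mulmx0 add0r.
Qed.

Lemma dotp_row m1 m2 (a c : 'rV[R]_m1) (b d : 'rV[R]_m2) :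
  dotp (row_mx a b) (row_mx c d) = dotp a c + dotp b d.
Proof. by rewrite /dotp tr_row_mx mul_row_col mxE. Qed.

Lemma dotp_scalar_mx (c : R) : dotp (c%:M : 'rV[R]_1) c%:M = c ^+ 2.
Proof. by rewrite dotpE big_ord1 !mxE eqxx mulr1n. Qed.

Lemma carrier_orbit_map t x y : sphere R k x -> sphere R l y ->
  carrier (orbit_map M t x y).
Proof.
rewrite /sphere /carrier /orbit_map /= => xx yy; case: M => /=.
  rewrite row_mxKl row_mxKr dotp_row dotpZ xx yy dotp_scalar_mx mulr1.
  by rewrite addrC cos2Dsin2.
by rewrite dotp_row !dotpZ xx yy !mulr1 addrC cos2Dsin2.
Qed.

Lemma height_orbit_map t x y : sphere R k x -> sphere R l y ->
  height (orbit_map M t x y) = cos t.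
Proof.
rewrite /sphere /height /orbit_map /= => xx yy; case: M => /=.
  by rewrite row_mxKl row_mxKr mxE eqxx mulr1n.
rewrite row_mxKl row_mxKr !dotpZ xx yy !mulr1.
by rewrite [t in RHS]splitr cosD -!expr2.
Qed.

(** Away from height 1 and -1 both projections are nonzero, so the two sphere
    tensors are smooth there. *)
Lemma carrier_interior p : carrier p -> -1 < height p < 1 ->
  0 < dotp (p *m Pi1) (p *m Pi1) /\ 0 < dotp (p *m Pi2) (p *m Pi2).
Proof.
rewrite /carrier /height /first_projection /second_projection.
move: p; case: M => p /=.
  move=> [p1 p2] /andP[h1 h2].
  rewrite -[p]hsubmxK !mul_row_col -[lsubmx p]hsubmxK mul_row_col.
  rewrite !mulmx0 !mulmx1 !addr0 add0r p2; split => //.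
  move: p1; rewrite -[in dotp _ _](hsubmxK (lsubmx p)) dotp_row.
  rewrite [in X in _ + X]dotpE big_ord1 => e.
  nra.
move=> pp /andP[h1 h2].
rewrite -[p]hsubmxK !mul_row_col !mulmx0 !mulmx1 !addr0 add0r.
by move: pp; rewrite -[in dotp _ _](hsubmxK p) dotp_row; lra.
Qed.

Lemma tangent_first p (w : 'rV[R]_(1 + k)) :
  dotp w (p *m Pi1) = 0 -> tangent p (w *m Pi1^T).
Proof.
rewrite /tangent /first_projection; move: p; case: M => p /=.
  rewrite -[p]hsubmxK -[lsubmx p]hsubmxK !mul_row_col !tr_col_mx !trmx0 trmx1.
  rewrite !mul_mx_row !mulmx0 !mulmx1 !addr0 !row_mxKl !row_mxKr.
  rewrite dotp_row => ->.
  by rewrite /dotp !mul0mx !mxE addr0.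
rewrite -[p]hsubmxK mul_row_col tr_col_mx trmx0 trmx1.
rewrite mul_mx_row !mulmx0 !mulmx1 addr0.
rewrite dotp_row => ->.
by rewrite /dotp !mul0mx !mxE addr0.
Qed.

Lemma tangent_second p (w : 'rV[R]_(1 + l)) :
  dotp w (p *m Pi2) = 0 -> tangent p (w *m Pi2^T).
Proof.
rewrite /tangent /second_projection; move: p; case: M => p /=.
  rewrite -[p]hsubmxK !mul_row_col !tr_col_mx !trmx0 trmx1.
  rewrite !mul_mx_row !mulmx0 !mulmx1 !add0r !row_mxKl !row_mxKr.
  move=> ->.
  by rewrite /dotp !mul0mx !mxE.
rewrite -[p]hsubmxK mul_row_col tr_col_mx trmx0 trmx1.
rewrite mul_mx_row !mulmx0 !mulmx1 add0r.
rewrite dotp_row => ->.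
by rewrite /dotp !mul0mx !mxE addr0.
Qed.

(** The rows of the sphere tensor are orthogonal to the position in the factor,
    hence give tangent vectors of M, and these are orthogonal to every normal
    vector. *)
Lemma normal_sphere_tensor d (Pi : 'M[R]_(N, d)) p nu :
  (forall w : 'rV[R]_d, dotp w (p *m Pi) = 0 -> tangent p (w *m Pi^T)) ->
  (forall v, tangent p v -> dotp nu v = 0) ->
  nu *m Pi *m sphere_tensor (p *m Pi) = 0.
Proof.
move=> tanP nuT; apply/rowP => j; rewrite [RHS]mxE.
set P := sphere_tensor _.
have := nuT (row j P *m Pi^T).
rewrite /dotp trmx_mul trmxK mulmxA tr_row /P sphere_tensor_sym -/P.
rewrite -[X in _ -> X = _]/((nu *m Pi *m P) 0 j).
have -> : (nu *m Pi *m P) 0 j = (nu *m Pi *m col j P) 0 0.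
  by rewrite [LHS]mxE [RHS]mxE; apply: eq_bigr => i _; rewrite [X in _ = _ * X]mxE.
apply; apply: tanP.
by rewrite /dotp -row_mul sphere_tensor_mul !mxE.
Qed.

(** For [chi (cos t) = sin(t)^2 phi(t)] this is phi (f_c^2 g^k / k - h_c^2 g^l / l):
    the factor sin^2 of the squared warping functions is absorbed in [chi]. *)
Definition split_field (chi : R -> R) (p : 'rV[R]_N) : 'M[R]_N :=
  if `[< carrier p >] then
    chi (height p) *:
      ((cone_factor k l k / k%:R) *:
         (Pi1 *m sphere_tensor (p *m Pi1) *m Pi1^T)
       - (cone_factor k l l / l%:R) *:
         (Pi2 *m sphere_tensor (p *m Pi2) *m Pi2^T))
  else 0.

Lemma split_field_symmetric chi : is_symmetric_tensor (split_field chi).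
Proof.
split.
- move=> p; rewrite /split_field; case: ifP => _; last exact: trmx0.
  have trZ (c : R) (A : 'M[R]_N) : (c *: A)^T = c *: A^T by rewrite linearZ.
  have trB (A B : 'M[R]_N) : (A - B)^T = A^T - B^T by rewrite raddfB.
  rewrite trZ trB !trZ 4!(trmx_mul, trmxK) !sphere_tensor_sym.
  by rewrite trmx_mul trmxK sphere_tensor_sym !mulmxA.
- by move=> p np; rewrite /split_field; case: asboolP.
- move=> p nu cp nuT; rewrite /split_field; case: asboolP => // _.
  have := normal_sphere_tensor (@tangent_first p) nuT.
  have := normal_sphere_tensor (@tangent_second p) nuT.
  move: (sphere_tensor (p *m Pi1)) (sphere_tensor (p *m Pi2)) => P1 P2 e2 e1.
  rewrite -scalemxAr mulmxBr -!scalemxAr !mulmxA e1 e2.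
  by rewrite !mul0mx !scaler0 subrr scaler0.
Qed.

Lemma smooth_height U : smooth_fun U height.
Proof.
have smooth_dotp m1 (f : 'I_m1 -> 'I_N) : smooth_fun U
    (fun p : 'rV[R]_N => \sum_j p 0 (f j) * p 0 (f j)).
  by apply: smooth_fun_sum => j; apply: smooth_mul; exact: smooth_coord.
move: U smooth_dotp; rewrite /height; case: M => /= U smooth_dotp.
  by under eq_fun do rewrite !mxE; exact: smooth_coord.
have -> : (fun p : 'rV[R]_((1 + k) + (1 + l)) =>
     dotp (rsubmx p) (rsubmx p) - dotp (lsubmx p) (lsubmx p)) =
   (fun p => \sum_j p 0 (rshift (1 + k) j) * p 0 (rshift (1 + k) j)
      + (-1) * \sum_j p 0 (lshift (1 + l) j) * p 0 (lshift (1 + l) j)).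
  apply/funext => p; rewrite mulN1r !dotpE; congr (_ - _);
    by apply: eq_bigr => j _; rewrite !mxE.
apply: smooth_add; first exact: smooth_dotp.
by apply: smooth_mul; [exact: smooth_cst|exact: smooth_dotp].
Qed.

Lemma smooth_fun_continuous m (f : 'rV[R]_m -> R) :
  smooth_fun setT f -> continuous f.
Proof.
move=> sf p; apply: differentiable_continuous.
exact: smooth_fun_differentiable sf _.
Qed.

Lemma smooth_projection U d (Pi : 'M[R]_(N, d)) j :
  smooth_fun U (fun p : 'rV[R]_N => (p *m Pi) 0 j).
Proof.
under eq_fun do rewrite mxE.
by apply: smooth_fun_sum => i; apply: smooth_mul;
  [exact: smooth_coord|exact: smooth_cst].
Qed.

Lemma smooth_projection_norm U d (Pi : 'M[R]_(N, d)) :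
  smooth_fun U (fun p : 'rV[R]_N => dotp (p *m Pi) (p *m Pi)).
Proof.
under eq_fun do rewrite dotpE.
by apply: smooth_fun_sum => i; apply: smooth_mul; exact: smooth_projection.
Qed.

Lemma smooth_projected_sphere_tensor U d (Pi : 'M[R]_(N, d)) i j :
  (forall p, U p -> dotp (p *m Pi) (p *m Pi) != 0) ->
  smooth_fun U (fun p => (Pi *m sphere_tensor (p *m Pi) *m Pi^T) i j).
Proof.
move=> Pi0.
under eq_fun do rewrite mxE; apply: smooth_fun_sum => a.
apply: smooth_mul; last exact: smooth_cst.
under eq_fun do rewrite mxE; apply: smooth_fun_sum => b.
apply: smooth_mul; first exact: smooth_cst.
have -> : (fun p => sphere_tensor (p *m Pi) b a) = (fun p : 'rV[R]_N =>
    (dotp (p *m Pi) (p *m Pi))^-1 * ((b == a)%:R +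
      (-1) * ((dotp (p *m Pi) (p *m Pi))^-1 *
              ((p *m Pi) 0 b * (p *m Pi) 0 a)))).
  apply/funext => p; rewrite /sphere_tensor; move: (p *m Pi) => x.
  by rewrite !mxE big_ord1 !mxE mulN1r.
have si := smooth_inv (smooth_projection_norm U Pi) Pi0.
apply: smooth_mul => //; apply: smooth_add; first exact: smooth_cst.
apply: smooth_mul; first exact: smooth_cst.
by apply: smooth_mul => //; apply: smooth_mul; exact: smooth_projection.
Qed.

(** Smoothness of [chi] on ]-1, 1[, phrased through compositions so that it is
    used and proved within the class of smooth functions above. *)
Definition smooth_on_interval (chi : R -> R) := forall m (U : set 'rV[R]_m) f,
  smooth_fun U f -> (forall p, U p -> -1 < f p < 1) ->
  smooth_fun U (fun p => chi (f p)).

(** The values of [chi] on [-1, 1] suffice because these are the heights of the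
    points of M. *)
Definition vanishes_near_ends (chi : R -> R) :=
  exists2 r : R, r < 1 & forall x, r < `|x| <= 1 -> chi x = 0.

Lemma carrier_height p : carrier p -> `|height p| <= 1.
Proof.
rewrite /carrier /height ler_norml; move: p; case: M => p /=.
  move=> [p1 _]; move: p1.
  rewrite -[in dotp _ _](hsubmxK (lsubmx p)) dotp_row [in X in _ + X]dotpE big_ord1.
  by have := dotp_ge0 (lsubmx (lsubmx p)); nra.
rewrite -[in dotp _ _](hsubmxK p) dotp_row => pp.
by have := dotp_ge0 (lsubmx p); have := dotp_ge0 (rsubmx p); lra.
Qed.

Lemma open_preimage_height (A : set R) : open A -> open (height @^-1` A).
Proof.
move=> oA; apply: open_comp => // p _.
exact: smooth_fun_continuous (smooth_height setT) p.
Qed.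

Lemma open_far_from_equator r : open [set p | r < `|height p|].
Proof.
rewrite (_ : [set p | _] = height @^-1` [set x | r < `|x|])//.
apply: open_preimage_height.
rewrite (_ : [set x | _] = Num.norm @^-1` [set y | r < y])//.
by apply: open_comp; [move=> x _; exact: norm_continuous|exact: open_gt].
Qed.

(** Near a point of height less than 1 in absolute value the defining formula is
    smooth; near the singular orbits the field is 0. *)
Lemma split_field_smooth chi :
  smooth_on_interval chi -> vanishes_near_ends chi -> is_smooth (split_field chi).
Proof.
move=> schi [r r1 chi0] p cp.
case: (ltP `|height p| 1) => [hp|hp]; last first.
  exists [set p | r < `|height p|], (fun=> 0); split.
  - exact: open_far_from_equator.
  - exact: lt_le_trans hp.
  - apply: smooth_on_mx; first exact: open_far_from_equator.
    move=> i j; rewrite (_ : (fun _ => _) = fun=> 0); first exact: smooth_cst.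
    by apply/funext => q /=; rewrite mxE.
  - move=> q /= rq cq; rewrite /split_field chi0 ?scale0r; first by case: ifP.
    by rewrite rq carrier_height.
pose U := [set q | [/\ -1 < height q < 1, 0 < dotp (q *m Pi1) (q *m Pi1) &
  0 < dotp (q *m Pi2) (q *m Pi2)]].
have oU : open U.
  have -> : U = (height @^-1` [set x | -1 < x]) `&` (height @^-1` [set x | x < 1])
     `&` ((fun q => dotp (q *m Pi1) (q *m Pi1)) @^-1` [set x | 0 < x]
     `&` (fun q => dotp (q *m Pi2) (q *m Pi2)) @^-1` [set x | 0 < x]).
    by apply/seteqP; split => q /=; [move=> [/andP[]]|move=> [[h1 h2] []]; split => //; rewrite h1].
  apply: openI; apply: openI.
  - by apply: open_preimage_height; exact: open_gt.
  - by apply: open_preimage_height; exact: open_lt.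
  - apply: open_comp; last exact: open_gt.
    by move=> q _; exact: smooth_fun_continuous (smooth_projection_norm setT _) _.
  - apply: open_comp; last exact: open_gt.
    by move=> q _; exact: smooth_fun_continuous (smooth_projection_norm setT _) _.
exists U, (fun q => chi (height q) *:
      ((cone_factor k l k / k%:R) *:
         (Pi1 *m sphere_tensor (q *m Pi1) *m Pi1^T)
       - (cone_factor k l l / l%:R) *:
         (Pi2 *m sphere_tensor (q *m Pi2) *m Pi2^T))); split => //.
- have hp' : -1 < height p < 1 by rewrite -ltr_norml.
  by have [? ?] := carrier_interior cp hp'; split.
- apply: smooth_on_mx => // i j.
  under eq_fun do rewrite mxE.
  apply: smooth_mul.
    by apply: schi; [exact: smooth_height|move=> q []].
  have entries (c d : R) (A B : 'M[R]_N) :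
      (c *: A - d *: B) i j = c * A i j + - d * B i j by rewrite !mxE mulNr.
  under eq_fun do rewrite entries.
  apply: smooth_add; (apply: smooth_mul; first exact: smooth_cst).
  - by apply: smooth_projected_sphere_tensor => q [_ [/lt0r_neq0]].
  - by apply: smooth_projected_sphere_tensor => q [_ [_ /lt0r_neq0]].
- by move=> q _ cq; rewrite /split_field; case: asboolP.
Qed.

Lemma split_field_vanishes chi :
  vanishes_near_ends chi -> vanishes_near_singular_orbits (split_field chi).
Proof.
move=> [r r1 chi0]; exists [set p | r < `|height p|]; split.
- exact: open_far_from_equator.
- move=> _ [t [x [y [tE xS yS ->]]]] /=.
  rewrite height_orbit_map//; case: tE => ->; first by rewrite cos0 normr1.
  by rewrite cospi normrN normr1.
- move=> p /= rp cp; rewrite /split_field chi0 ?scale0r; first by case: ifP.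
  by rewrite rp carrier_height.
Qed.

End Model.

Arguments split_field {R} M k l chi p.

(** * Integrals of the round density *)

Section LowerBound.
Context {R : realType}.
Local Notation mu := (@lebesgue_measure R).

Lemma Rintegral_ge_itv (D : set R) (f : R -> R) (x y m : R) :
  measurable D -> mu.-integrable D (EFin \o f) ->
  (forall s, D s -> 0 <= f s) -> `[x, y] `<=` D -> x < y ->
  (forall s, s \in `[x, y] -> m <= f s) ->
  m * (y - x) <= \int[mu]_(s in D) f s.
Proof.
move=> mD fD f0 xyD xy mf.
have mI : measurable (`[x, y]%classic : set R) by [].
have muI : mu `[x, y]%classic = (y - x)%:E.
  by rewrite lebesgue_measure_itv/= lte_fin xy.
have fI : mu.-integrable `[x, y] (EFin \o f) by exact: integrableS fD.
have DE : `[x, y]%classic `|` (D `\` `[x, y]) = D by exact: setDUK.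
suff : m * (y - x) <= \int[mu]_(s in `[x, y]%classic `|` (D `\` `[x, y])) f s.
  by rewrite DE.
rewrite Rintegral_setU//; last 3 first.
- exact: measurableD.
- by rewrite DE.
- by apply/disj_setPS => s [? [_ ?]].
apply: ler_wpDr; first by apply: Rintegral_ge0 => s [Ds _]; exact: f0.
have -> : m * (y - x) = \int[mu]_(s in `[x, y]) m.
  by rewrite Rintegral_cst//; congr (_ * _); rewrite -[LHS]/(fine (y - x)%:E) -muI.
apply: le_Rintegral => //.
  apply: measurable_bounded_integrable => //.
    by rewrite [X in (X < _)%E]muI ltry.
  exact: bounded_cst.
Qed.

End LowerBound.

Section InverseQuadraticIntegral.
Context {R : realType}.
Local Notation mu := (@lebesgue_measure R).

(** The n-fold iterated integral of (a + |u|^2)^(-p) over R^n, as a function of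
    a; the summands s^2 of the outer integrals are added to a one by one. *)
Fixpoint inverse_integral (n p : nat) (a : R) : R :=
  match n with
  | 0%N => a ^- p
  | n'.+1 => \int[mu]_s inverse_integral n' p (a + s ^+ 2)
  end.
Local Notation W := inverse_integral.

Lemma integrable_inv_oneDsqr :
  mu.-integrable [set: R] (EFin \o (fun x : R => (1 + x ^+ 2)^-1)).
Proof.
have c : continuous (fun x : R => (1 + x ^+ 2)^-1).
  exact: continuous_oneDsqrV.
apply/integrableP; split.
  by apply/measurable_EFinP; exact: continuous_measurable_fun.
under eq_integral do rewrite /= ger0_norm ?invr_ge0 ?addr_ge0 ?sqr_ge0//.
rewrite ge0_symfun_integralT//=.
- rewrite (_ : [set x | _] = `[0, +oo[%classic); last first.
    by apply/seteqP; split => x/=; rewrite in_itv/= andbT.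
  by have := @integral0y_oneDsqr R; rewrite /oneDsqr => ->; rewrite -EFinM ltry.
- by move=> x; rewrite invr_ge0 addr_ge0// sqr_ge0.
- by move=> x/=; rewrite sqrrN.
Qed.

(** The four statements are proved together: monotonicity in [a] gives
    measurability of the next integrand, and the third statement dominates it by
    a multiple of 1 / (1 + s^2). *)
Lemma inverse_integralP n :
  (forall p a, (n <= p)%N -> 1 <= a -> 0 < W n p a) /\
  (forall p a b, (n <= p)%N -> 1 <= a -> a <= b -> W n p b <= W n p a) /\
  (forall p a, (n <= p)%N -> 1 <= a -> W n p.+1 a <= W n p a / a) /\
  (forall p a, (n < p)%N -> 1 <= a ->
     mu.-integrable [set: R] (EFin \o (fun s => W n p (a + s ^+ 2)))).
Proof.
have step m : (forall p a, (m <= p)%N -> 1 <= a -> 0 < W m p a) ->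
  (forall p a b, (m <= p)%N -> 1 <= a -> a <= b -> W m p b <= W m p a) ->
  (forall p a, (m <= p)%N -> 1 <= a -> W m p.+1 a <= W m p a / a) ->
  (forall p a, (m < p)%N -> 1 <= a ->
     mu.-integrable [set: R] (EFin \o (fun s => W m p (a + s ^+ 2)))).
  move=> pos dec ratio [//|p] a mp a1.
  have a1s (s : R) : 1 <= a + s ^+ 2 by rewrite (le_trans a1)// lerDl sqr_ge0.
  (* Monotone only on [1, +oo[, hence extended by its value at 1. *)
  pose V (x : R) := W m p.+1 (Num.max 1 x).
  have mV : measurable_fun [set: R] V.
    apply: nonincreasing_measurable => // x y xy.
    by apply: dec; rewrite ?(leq_trans mp)//; [exact: ltnW|rewrite le_max lexx|
      rewrite ge_max !le_max lexx/= xy orbT].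
  have mW : measurable_fun [set: R] (fun s => W m p.+1 (a + s ^+ 2)).
    rewrite (_ : (fun s => _) = V \o (fun s => a + s ^+ 2)); last first.
      by apply/funext => s /=; rewrite /V max_r.
    apply: measurableT_comp => //.
    by apply: measurable_funD => //; exact: measurable_funX.
  have iW := integrableZl measurableT (W m p 1) integrable_inv_oneDsqr.
  apply: (le_integrable _ _ _ iW) => //; first exact/measurable_EFinP.
  move=> s _ /=; rewrite lee_fin !ger0_norm; last 2 first.
  - rewrite mulr_ge0 ?invr_ge0 ?addr_ge0 ?sqr_ge0//; apply: ltW; exact: pos (lexx _).
  - by apply: ltW; exact: pos (ltnW mp) _.
  apply: (le_trans (ratio _ _ mp (a1s s))).
  apply: ler_pM.
  - by apply: ltW; exact: pos.
  - by rewrite invr_ge0 (le_trans ler01).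
  - exact: dec.
  - by rewrite lef_pV2 ?posrE ?(lt_le_trans ltr01)// ?lerD2r// lerDl sqr_ge0.
elim: n => [|n [pos [dec [ratio int]]]].
  have pos0 p a : (0 <= p)%N -> 1 <= a -> 0 < W 0 p a.
    by move=> _ a1; rewrite /= invr_gt0 exprn_gt0// (lt_le_trans ltr01).
  have dec0 p a b : (0 <= p)%N -> 1 <= a -> a <= b -> W 0 p b <= W 0 p a.
    move=> _ a1 ab; have a0 := lt_le_trans ltr01 a1.
    rewrite /= lef_pV2 ?posrE ?exprn_gt0//; last exact: lt_le_trans ab.
    by rewrite lerXn2r ?nnegrE ?(ltW a0)// (le_trans (ltW a0)).
  have ratio0 p a : (0 <= p)%N -> 1 <= a -> W 0 p.+1 a <= W 0 p a / a.
    by move=> _ a1; rewrite /= exprSr invfM.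
  by split => //; split => //; split => //; exact: step.
have pos' p a : (n < p)%N -> 1 <= a -> 0 < W n.+1 p a.
  move=> np a1 /=; have a2 : 1 <= a + 1 by rewrite (le_trans a1)// lerDl.
  have p0 : 0 < W n p (a + 1) by exact: pos (ltnW np) _.
  apply: (lt_le_trans p0); rewrite -[leLHS]mulr1 -[X in _ * X]subr0.
  apply: Rintegral_ge_itv => //.
  - exact: int.
  - move=> s _; apply: ltW; apply: pos (ltnW np) _.
    by rewrite (le_trans a1)// lerDl sqr_ge0.
  - move=> s; rewrite in_itv/= => /andP[s0 s1]; apply: dec; rewrite ?(ltnW np)//.
      by rewrite (le_trans a1)// lerDl sqr_ge0.
    by rewrite lerD2l expr_le1.
have dec' p a b : (n < p)%N -> 1 <= a -> a <= b -> W n.+1 p b <= W n.+1 p a.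
  move=> np a1 ab /=; apply: le_Rintegral => //; first exact: int (le_trans a1 ab).
    exact: int.
  move=> s _; apply: dec; rewrite ?(ltnW np)//; last by rewrite lerD2r.
  by rewrite (le_trans a1)// lerDl sqr_ge0.
have ratio' p a : (n < p)%N -> 1 <= a -> W n.+1 p.+1 a <= W n.+1 p a / a.
  move=> np a1 /=; rewrite mulrC -RintegralZl//; last exact: int.
  apply: le_Rintegral => //; first by apply: int => //; exact: ltnW.
    exact: (integrableZl measurableT a^-1 (int _ _ np a1)).
  move=> s _; have as1 : 1 <= a + s ^+ 2 by rewrite (le_trans a1)// lerDl sqr_ge0.
  apply: (le_trans (ratio _ _ (ltnW np) as1)); rewrite mulrC.
  apply: ler_wpM2r; first by apply: ltW; exact: pos (ltnW np) _.
  by rewrite lef_pV2 ?posrE ?(lt_le_trans ltr01)// lerDl sqr_ge0.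
by split => //; split => //; split => //; exact: step.
Qed.

Lemma Rn_integral_inverse n p (a c : R) : (n <= p)%N -> 1 <= a ->
  Rn_integral (fun u : 'rV[R]_n => c * (a + dotp u u) ^- p) = c * W n p a.
Proof.
elim: n a => [|n ih] a np a1 /=.
  by rewrite dotpE big_ord0 addr0.
transitivity (\int[mu]_s (c * W n p (a + s ^+ 2))).
  apply: eq_Rintegral => s _; rewrite -ih ?(ltnW np)//; last first.
    by rewrite (le_trans a1)// lerDl sqr_ge0.
  congr Rn_integral; apply/funext => z.
  congr (c * _ ^- p); rewrite -addrA; congr (a + _).
  by have := dotp_row (s%:M : 'M[R]_1) (s%:M : 'M[R]_1) z z; rewrite dotp_scalar_mx.
rewrite RintegralZl//.
by have [_ [_ [_ int]]] := inverse_integralP n; exact: int.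
Qed.

(** The volume of a sphere in a stereographic chart; it enters the quadratic form
    as a positive factor. *)
Lemma Rn_integral_round_density n : exists2 w : R, 0 < w &
  forall c, Rn_integral (fun u : 'rV[R]_n => c * (2 / (1 + dotp u u)) ^+ n) = c * w.
Proof.
exists (2 ^+ n * W n n 1).
  by rewrite mulr_gt0 ?exprn_gt0//; have [pos _] := inverse_integralP n; exact: pos.
move=> c; rewrite mulrA -Rn_integral_inverse//; congr Rn_integral.
by apply/funext => u; rewrite expr_div_n mulrA.
Qed.

End InverseQuadraticIntegral.

(** * Components of the tensor fields and their quadratic form *)

Section JacobianRules.
Context {R : realType} {m : nat}.
Implicit Types z : 'rV[R]_m.

Lemma jacobian_mulmx n d (F : 'rV[R]_m -> 'rV[R]_n) (Pi : 'M[R]_(n, d)) z :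
  (forall j, differentiable (fun y => F y 0 j) z) ->
  'J F z *m Pi = 'J (fun y => F y *m Pi) z.
Proof.
move=> dF; have E j (y : 'rV[R]_m) : (F y *m Pi) 0 j = \sum_i F y 0 i * Pi i j by rewrite mxE.
have dE j : differentiable (fun y => (F y *m Pi) 0 j) z.
  under eq_fun do rewrite E.
  rewrite (_ : (fun _ => _) = \sum_i (fun y => F y 0 i * Pi i j)).
    by apply: differentiable_sum => i; apply: differentiableM.
  by apply/funext => y; rewrite fct_sumE.
apply/matrixP => a j; rewrite [RHS]jacobianE// mxE.
apply/esym/partialE; under eq_fun do rewrite E.
apply: is_derive_fun_sum => i; rewrite jacobianE//.
have h := is_derive_fun_mul (derivableP (diff_derivable (v := delta_mx 0 a) (dF i)))
  (is_derive_const_fun (Pi i j) _ _).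
by apply: is_derive_eq h _; rewrite mulr0 addr0.
Qed.

Lemma jacobian_scale d (r : 'rV[R]_m -> R) (x : 'rV[R]_m -> 'rV[R]_d) z :
  differentiable r z -> (forall j, differentiable (fun y => x y 0 j) z) ->
  'J (fun y => r y *: x y) z =
    (\col_a partial a r z) *m x z + r z *: 'J x z.
Proof.
move=> dr dx; have E j : (fun y => (r y *: x y) 0 j) = (fun y => r y * x y 0 j).
  by apply/funext => y; rewrite mxE.
have dE j : differentiable (fun y => (r y *: x y) 0 j) z.
  by rewrite E; exact: differentiableM.
have entries (A : 'cV[R]_m) (B : 'M[R]_(m, d)) a j :
    (A *m x z + r z *: B) a j = A a 0 * x z 0 j + r z * B a j.
  by rewrite !mxE big_ord1.
apply/matrixP => a j; apply: etrans (jacobianE a j dE) _.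
apply: esym; apply: etrans (entries _ _ _ _) _; apply: esym.
rewrite (jacobianE a j dx) [X in _ = X * _ + _]mxE.
apply: partialE; rewrite E.
exact: is_derive_fun_mul (derivableP (diff_derivable dr))
  (derivableP (diff_derivable (dx j))).
Qed.

Lemma jacobian_sphere d (x : 'rV[R]_m -> 'rV[R]_d) z :
  (forall j, differentiable (fun y => x y 0 j) z) ->
  (forall y, dotp (x y) (x y) = 1) -> 'J x z *m (x z)^T = 0.
Proof.
move=> dx xx; apply/matrixP => a j; rewrite (ord1 j) mxE [RHS]mxE.
have d1 : partial a (fun y => \sum_j x y 0 j * x y 0 j) z =
    \sum_j (partial a (fun y => x y 0 j) z * x z 0 j
            + x z 0 j * partial a (fun y => x y 0 j) z).
  apply: partialE; apply: is_derive_fun_sum => i.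
  by apply: is_derive_fun_mul; exact: derivableP (diff_derivable (dx i)).
have d2 : partial a (fun y => \sum_j x y 0 j * x y 0 j) z = 0.
  apply: partialE; rewrite (_ : (fun y => _) = fun=> 1).
    exact: is_derive_const_fun.
  by apply/funext => y; rewrite -dotpE.
have e : 2 * \sum_j partial a (fun y => x y 0 j) z * x z 0 j = 0.
  by rewrite -[RHS]d2 d1 mulr_sumr; apply: eq_bigr => i _; ring.
transitivity (\sum_j partial a (fun y => x y 0 j) z * x z 0 j); last by lra.
by apply: eq_bigr => i _; rewrite (jacobianE a i dx) [X in _ * X]mxE.
Qed.

End JacobianRules.

Section SplitFieldGeometry.
Context {R : realType} (M : model) (k l : nat).
Hypotheses (k2 : (2 <= k)%N) (l2 : (2 <= l)%N).
Local Notation n := ((1 + k) + l)%N.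
Local Notation i0 := (radial_index k l).
Local Notation Pi1 := (first_projection M k l).
Local Notation Pi2 := (second_projection M k l).
Implicit Types z : 'rV[R]_n.

Lemma coord_x_sphere b z : sphere R k (coord_x b z).
Proof. by rewrite coord_xE; exact: stereo_coord_sphere. Qed.

Lemma coord_y_sphere b z : sphere R l (coord_y b z).
Proof. by rewrite coord_yE; exact: stereo_coord_sphere. Qed.

Lemma differentiable_coord_x b z j :
  differentiable (fun y : 'rV[R]_n => coord_x b y 0 j) z.
Proof. by rewrite coord_xE; exact: differentiable_stereo_coord. Qed.

Lemma differentiable_coord_y b z j :
  differentiable (fun y : 'rV[R]_n => coord_y b y 0 j) z.
Proof. by rewrite coord_yE; exact: differentiable_stereo_coord. Qed.

Lemma differentiable_radial (f : R -> R) z :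
  (forall t, derivable f t 1) ->
  differentiable (fun y : 'rV[R]_n => f (coord_t y 0 0)) z.
Proof.
move=> df; under eq_fun do rewrite coord_tE.
apply: (@differentiable_comp _ _ _ _ (fun y : 'rV[R]_n => y 0 i0) f).
  exact: differentiable_coord.
by apply/derivable1_diffP; exact: df.
Qed.

Lemma derivable_half (f : R -> R) (t : R) :
  (forall s, derivable f s 1) -> derivable (fun s : R => f (s / 2)) t 1.
Proof.
move=> df.
have h : is_derive t (1 : R) (fun s : R => s * 2^-1) (1 * 2^-1 + t * 0).
  exact: is_derive_fun_mul (is_derive_id _ _) (is_derive_const_fun _ _ _).
by have [] := is_derive_fun_comp (f := fun s : R => s * 2^-1) (derivableP (df (t / 2))) h.
Qed.

Lemma derivable_first_radius (t : R) : derivable (first_radius M : R -> R) t 1.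
Proof.
rewrite /first_radius; case: M; first exact: derivable_sin.
by apply: derivable_half => s; exact: derivable_sin.
Qed.

Lemma derivable_second_radius (t : R) : derivable (second_radius M : R -> R) t 1.
Proof.
rewrite /second_radius; case: M; first exact: derivable_cst.
by apply: derivable_half => s; exact: derivable_cos.
Qed.

Lemma radii_neq0 (t : R) : sin t != 0 ->
  first_radius M t != 0 /\ second_radius M t != 0.
Proof.
rewrite /first_radius /second_radius; case: M => [s0|].
  by rewrite s0 oner_neq0.
rewrite {1}[t]splitr sinD => s0; split; apply: contraNneq s0 => ->.
  by rewrite mul0r mulr0 addr0.
by rewrite mul0r mulr0 addr0.
Qed.

Lemma differentiable_chart b c z j :
  differentiable (fun y : 'rV[R]_n => chart M b c y 0 j) z.
Proof.
have dx := differentiable_coord_x; have dy := differentiable_coord_y.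
have dr (f : R -> R) := @differentiable_radial f z.
move: j; rewrite /chart /orbit_map; case: M => j.
- rewrite -(splitK j); case: (fintype.split j) => {}j /=.
    under eq_fun do rewrite row_mxEl.
    rewrite -(splitK j); case: (fintype.split j) => {}j /=.
      under eq_fun do rewrite row_mxEl mxE.
      apply: differentiableM; last exact: dx.
      by apply: dr => t; exact: derivable_sin.
    rewrite (ord1 j); under eq_fun do rewrite row_mxEr mxE eqxx mulr1n.
    by apply: dr => t; exact: derivable_cos.
  under eq_fun do rewrite row_mxEr.
  exact: dy.
- rewrite -(splitK j); case: (fintype.split j) => {}j /=.
    under eq_fun do rewrite row_mxEl mxE.
    apply: differentiableM; last exact: dx.
    apply: (dr (fun t => sin (t / 2))) => t.
    by apply: derivable_half => s; exact: derivable_sin.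
  under eq_fun do rewrite row_mxEr mxE.
  apply: differentiableM; last exact: dy.
  apply: (dr (fun t => cos (t / 2))) => t.
  by apply: derivable_half => s; exact: derivable_cos.
Qed.

(** The derivative of the chart projected to one factor is a multiple of the
    position plus the radius times the derivative of the unit vector; the sphere
    tensor sees the second part only. *)
Lemma components_split_field chi b c z : sin (z 0 i0) != 0 ->
  components b c (split_field M k l chi) z =
  chi (cos (z 0 i0)) *:
    ((cone_factor k l k / k%:R) *: pullback_euclidean (coord_x b) z
     - (cone_factor k l l / l%:R) *: pullback_euclidean (coord_y c) z).
Proof.
move=> sz; have [r1 r2] := radii_neq0 sz.
have xS := coord_x_sphere b; have yS := coord_y_sphere c.
rewrite /components /split_field asboolT; last exact: carrier_orbit_map.
rewrite height_orbit_map// coord_tE.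
have dchart j := differentiable_chart b c z j.
have pull d (Pi : 'M[R]_(ambient_dim M k l, d)) (S : 'M[R]_d) :
   'J (chart M b c) z *m (Pi *m S *m Pi^T) *m ('J (chart M b c) z)^T =
   ('J (chart M b c) z *m Pi) *m S *m ('J (chart M b c) z *m Pi)^T.
  by rewrite trmx_mul !mulmxA.
have lin (J : 'M[R]_(n, ambient_dim M k l)) (u v w : R) A B :
    J *m (u *: (v *: A - w *: B)) *m J^T =
    u *: (v *: (J *m A *m J^T) - w *: (J *m B *m J^T)).
  by rewrite -scalemxAr -scalemxAl mulmxBr mulmxBl -!scalemxAr -!scalemxAl.
rewrite lin !pull.
have J1 : 'J (chart M b c) z *m Pi1 =
    (\col_a partial a (fun y => first_radius M (coord_t y 0 0)) z) *m coord_x b z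
    + first_radius M (coord_t z 0 0) *: 'J (coord_x b) z.
  apply: etrans (jacobian_mulmx _ dchart) _.
  have -> : (fun y : 'rV[R]_n => chart M b c y *m Pi1) =
      (fun y => first_radius M (coord_t y 0 0) *: coord_x b y).
    by apply/funext => y; exact: orbit_map_first.
  apply: jacobian_scale; last by move=> j; exact: differentiable_coord_x.
  by apply: differentiable_radial; exact: derivable_first_radius.
have J2 : 'J (chart M b c) z *m Pi2 =
    (\col_a partial a (fun y => second_radius M (coord_t y 0 0)) z) *m coord_y c z
    + second_radius M (coord_t z 0 0) *: 'J (coord_y c) z.
  apply: etrans (jacobian_mulmx _ dchart) _.
  have -> : (fun y : 'rV[R]_n => chart M b c y *m Pi2) =
      (fun y => second_radius M (coord_t y 0 0) *: coord_y c y).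
    by apply/funext => y; exact: orbit_map_second.
  apply: jacobian_scale; last by move=> j; exact: differentiable_coord_y.
  by apply: differentiable_radial; exact: derivable_second_radius.
have Jx := jacobian_sphere (differentiable_coord_x b z) xS.
have Jy := jacobian_sphere (differentiable_coord_y c z) yS.
move: J1 J2; move: ('J (chart M b c) z *m Pi1) ('J (chart M b c) z *m Pi2).
move=> X1 X2 E1 E2; rewrite orbit_map_first orbit_map_second !coord_tE.
rewrite !coord_tE in E1 E2.
have P1 : X1 *m sphere_tensor (first_radius M (z 0 i0) *: coord_x b z) *m X1^T
    = pullback_euclidean (coord_x b) z.
  by rewrite E1; exact: (sphere_tensor_congruence _ (xS z) r1 Jx).
have P2 : X2 *m sphere_tensor (second_radius M (z 0 i0) *: coord_y c z) *m X2^T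
    = pullback_euclidean (coord_y c) z.
  rewrite E2. exact: (sphere_tensor_congruence _ (yS z) r2 Jy).
by rewrite P1 P2.
Qed.

Context (chi phi phi1 phi2 : R -> R).
Hypothesis chiE : forall t, 0 < sin t -> chi (cos t) = sin t ^+ 2 * phi t.
Hypothesis dphi : forall t, 0 < sin t -> is_derive t 1 phi (phi1 t).
Hypothesis dphi1 : forall t, 0 < sin t -> is_derive t 1 phi1 (phi2 t).

Local Notation bl := (@block k l).
Local Notation gam := (@block_factor R k l).
Local Notation s := (@split_weight R k l).

Lemma components_split_fieldE b c z i j : regular_points i0 z ->
  components b c (split_field M k l chi) z i j =
  phi (z 0 i0) * split_tensor i0 bl gam s i j z.
Proof.
move=> Dz; rewrite components_split_field ?gt_eqF//.
have entries (x u v : R) (A B : 'M[R]_n) :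
   (x *: (u *: A - v *: B)) i j = x * (u * A i j - v * B i j) by rewrite !mxE.
rewrite entries pullback_coord_x pullback_coord_y chiE// /split_tensor /warped.
case: (indexP i) => [|i'|i'].
- by rewrite eqxx split_weight0 block0 /= ?mulr0n; ring.
- rewrite -block_radial /s block1 block0 /block_factor /= ?mulr0n ?mulr1n; ring.
- rewrite -block_radial /s block2 block0 /block_factor /= ?mulr0n ?mulr1n; ring.
Qed.

Let gam0 i : gam (bl i) != 0.
Proof. by rewrite gt_eqF// block_factor_gt0. Qed.

Lemma coord_domain_regular z : coord_domain z -> regular_points i0 z.
Proof.
by rewrite /coord_domain /regular_points /= coord_tE => /sin_gt0_pi.
Qed.

Lemma split_field_TT : is_TT (split_field M k l chi).
Proof.
move=> b c z /coord_domain_regular Dz; rewrite cone_metricE//; split.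
  move=> j; apply: (divergence_warped (@block_radial k l) gam0 _ _ _ dphi _ j Dz).
  - exact: split_weight0.
  - exact: sum_split_weight.
  - exact: split_weight_block.
  - by move=> *; exact: components_split_fieldE.
apply: (metric_trace_warped gam0 _ _ Dz).
  exact: sum_split_weight.
by move=> *; exact: components_split_fieldE.
Qed.

(** Each of the k + l fibre coordinates contributes one factor sin. *)
Lemma volume_densityE z : regular_points i0 z ->
  volume_density (diag_metric (warped i0 bl gam)) z =
  Num.sqrt (cone_factor k l k ^+ k * cone_factor k l l ^+ l)
  * sin (z 0 i0) ^+ (k + l)
  * (conformal bl 1 z ^+ k * conformal bl 2 z ^+ l).
Proof.
move=> Dz; rewrite /volume_density det_diag_metric.
have -> : \prod_i warped i0 bl gam i z =
   (cone_factor k l k ^+ k * cone_factor k l l ^+ l)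
  * (sin (z 0 i0) ^+ (k + l)
  * (conformal bl 1 z ^+ k * conformal bl 2 z ^+ l)) ^+ 2.
  rewrite big_split_ord/= big_split_ord/= big_ord1 -/i0 warped0 mul1r.
  rewrite (eq_bigr (fun=> cone_factor k l k * sin (z 0 i0) ^+ 2
     * conformal bl 1 z ^+ 2)); last first.
    by move=> j _; rewrite -/(first_index l j) /warped -block_radial block1 block0.
  rewrite [X in _ * X = _](eq_bigr (fun=> cone_factor k l l * sin (z 0 i0) ^+ 2
     * conformal bl 2 z ^+ 2)); last first.
    by move=> j _; rewrite -/(second_index k j) /warped -block_radial block2 block0.
  rewrite !prodr_const !card_ord.
  move: (cone_factor k l k) (cone_factor k l l) (conformal bl 1 z)
    (conformal bl 2 z) (sin _) => fk fl r1 r2 t.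
  rewrite exprD !exprMn -!exprM !muln2 -!addnn !exprD.
  by ring.
have cg := fun d d2 => ltW (cone_factor_gt0 (R := R) k2 l2 (d := d) d2).
rewrite sqrtrM ?mulr_ge0 ?exprn_ge0 ?cg// sqrtr_sqr ger0_norm ?mulrA//.
by rewrite !mulr_ge0 ?exprn_ge0// ltW// conformal_gt0.
Qed.

End SplitFieldGeometry.

(** The integrand is a function of t times the densities of the two spheres, so
    the inner integrals contribute a positive constant that does not depend on
    the field. *)
Lemma Q_c_split_field {R : realType} (M : model) (k l : nat) :
  (2 <= k)%N -> (2 <= l)%N ->
  exists2 C : R, 0 < C & forall chi phi phi1 phi2 : R -> R,
    (forall t, 0 < sin t -> chi (cos t) = sin t ^+ 2 * phi t) ->
    (forall t, 0 < sin t -> is_derive t 1 phi (phi1 t)) ->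
    (forall t, 0 < sin t -> is_derive t 1 phi1 (phi2 t)) ->
    Q_c R M k l (split_field M k l chi) =
    \int[@lebesgue_measure R]_(t in `]0, pi[)
      (C * (lichnerowicz_radial (n := (1 + k) + l) phi phi1 phi2 t * phi t
            * sin t ^+ (k + l))).
Proof.
move=> k2 l2.
pose s := @split_weight R k l; pose bl := @block k l; pose i0 := radial_index k l.
have gam0 i : @block_factor R k l (bl i) != 0.
  by rewrite gt_eqF// block_factor_gt0.
have [w1 w10 w1E] := @Rn_integral_round_density R k.
have [w2 w20 w2E] := @Rn_integral_round_density R l.
pose C0 : R := (\sum_i s i ^+ 2)
  * Num.sqrt (cone_factor k l k ^+ k * cone_factor k l l ^+ l).
have C00 : 0 < C0.
  rewrite mulr_gt0 ?sum_split_weight_sqr// sqrtr_gt0.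
  by rewrite mulr_gt0// exprn_gt0// cone_factor_gt0.
exists (C0 * w1 * w2).
  by apply: mulr_gt0 => //; apply: mulr_gt0.
move=> chi phi phi1 phi2 chiE dphi dphi1; rewrite /Q_c /L2_inner.
apply: eq_Rintegral => t; rewrite inE/= in_itv/= => t0pi.
set B := lichnerowicz_radial _ _ _ _ * _ * _.
transitivity (Rn_integral (fun u : 'rV[R]_k =>
   (C0 * B * w2) * (2 / (1 + dotp u u)) ^+ k)); last by rewrite w1E; ring.
congr Rn_integral; apply/funext => u.
transitivity (Rn_integral (fun v : 'rV[R]_l =>
   (C0 * B * (2 / (1 + dotp u u)) ^+ k) * (2 / (1 + dotp v v)) ^+ l)); last first.
  by rewrite w2E; ring.
congr Rn_integral; apply/funext => v.
set z := row_mx _ v.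
have zt : z 0 i0 = t.
  by rewrite /z /i0 row_mxEl row_mxEl mxE eqxx mulr1n.
have Dz : regular_points i0 z by rewrite /regular_points /= zt sin_gt0_pi.
have z1 : conformal bl 1 z = 2 / (1 + dotp u u).
  rewrite /conformal sum_block1 dotpE; congr (2 / (1 + _)).
  by apply: eq_bigr => j _; rewrite /z row_mxEl row_mxEr expr2.
have z2 : conformal bl 2 z = 2 / (1 + dotp v v).
  rewrite /conformal sum_block2 dotpE; congr (2 / (1 + _)).
  by apply: eq_bigr => j _; rewrite /z row_mxEr expr2.
rewrite cone_metricE// volume_densityE//.
rewrite (tensor_inner_warped (@block_radial k l) gam0 _ _ _ _ dphi dphi1 _ Dz (s := s)).
- by rewrite z1 z2 zt /C0 /B; ring.
- by move=> i; exact: block_factorE.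
- exact: split_weight0.
- exact: sum_split_weight.
- exact: split_weight_block.
- by move=> *; exact: components_split_fieldE.
Qed.

(** * A flat function which is a subsolution *)

Section FlatFunctions.
Context {R : realType}.
Implicit Types (P : {poly R}) (x y : R).

(** The rate [e] is arbitrary so that the induction can spend half of it on the
    factor y of each step. *)
Lemma poly_le_exp P (e : R) : 0 < e ->
  exists2 C, 0 <= C & forall y, 0 <= y -> `|P.[y]| <= C * expR (e * y).
Proof.
elim/poly_ind: P e => [|P c ih] e e0.
  by exists 0 => // y _; rewrite horner0 normr0 mul0r.
have [C C0 hC] := ih (e / 2) (divr_gt0 e0 (ltr0Sn _ 1)).
exists (C * (2 / e) + `|c|) => [|y y0].
  by rewrite addr_ge0// mulr_ge0// divr_ge0// ltW.
rewrite hornerMXaddC (le_trans (ler_normD _ _))// mulrDl lerD//; last first.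
  by rewrite ler_peMr// (le_trans _ (expR_ge1Dx _))// lerDl mulr_ge0// ltW.
have ye : y <= 2 / e * expR (e / 2 * y).
  rewrite -ler_pdivrMl ?divr_gt0// invf_div.
  by rewrite (le_trans _ (expR_ge1Dx _))// lerDr.
have -> : e * y = e / 2 * y + e / 2 * y by field.
rewrite expRD normrM (ger0_norm y0).
apply: le_trans (ler_pM (normr_ge0 _) y0 (hC _ y0) ye) _.
by rewrite le_eqVlt; apply/orP; left; apply/eqP; ring.
Qed.

Lemma is_derive_quadratic_bound (f : R -> R) (C : R) : f 0 = 0 ->
  (forall x, `|f x| <= C * x ^+ 2) -> is_derive (0 : R) 1 f 0.
Proof.
move=> f0 fC; have C0 : 0 <= C.
  by have := fC 1; rewrite expr1n mulr1; exact: le_trans.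
have lim0 : h^-1 *: ((f \o shift (0 : R)) (h *: (1 : R)) - f 0) @[h --> (0 : R)^'] --> (0 : R).
  apply/cvgrPdist_le => e e0.
  have C1 : 0 < C + 1 by rewrite ltr_wpDl.
  exists (e / (C + 1)); first by rewrite /= divr_gt0.
  move=> h /=; rewrite sub0r normrN => he h0.
  rewrite sub0r normrN f0 subr0 addr0 [h%:A]mulr1 normrZ normfV.
  rewrite ler_pdivrMl ?normr_gt0//.
  apply: (le_trans (fC h)); rewrite -real_normK ?num_real// expr2 mulrA mulrC.
  apply: ler_wpM2l => //.
  apply: (@le_trans _ _ ((C + 1) * `|h|)); first by apply: ler_wpM2r => //; rewrite lerDl.
  by rewrite mulrC -ler_pdivlMr// ltW.
split; last exact/cvg_lim.
by apply/cvg_ex; exists 0.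
Qed.

(** The functions P(1/x) exp(-2/x), extended by 0, form a class closed under
    differentiation; this gives all derivatives of exp(-2/x) at once. *)
Definition flat P x : R := if 0 < x then P.[x^-1] * expR (-2 * x^-1) else 0.

Definition flat_deriv P : {poly R} := 'X^2 * (P *+ 2 - P^`()).

(** At 0 the quotient P(1/x) exp(-2/x) / x tends to 0, because
    y^2 |P(y)| <= C exp(y) for y = 1/x, which leaves a bound C x^2 for the
    function. *)
Lemma is_derive_flat P x : is_derive x 1 (flat P) (flat (flat_deriv P) x).
Proof.
case: (ltgtP x 0) => [x0|x0|->].
- have -> : flat (flat_deriv P) x = 0 by rewrite /flat ltNge (ltW x0).
  apply: (near_eq_is_derive _ (is_derive_const_fun 0 x (1 : R))).
  near=> y; rewrite /flat ltNge ifF//; apply/negbF/ltW.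
  by near: y; exact: lt_nbhsl.
- have -> : flat (flat_deriv P) x = (flat_deriv P).[x^-1] * expR (-2 * x^-1).
    by rewrite /flat x0.
  have xn0 : x != 0 by rewrite gt_eqF.
  have dV : is_derive x (1 : R) (fun y : R => y^-1) (- 1 * (x^-1 * x^-1)).
    exact: is_derive_fun_inv xn0 (is_derive_id _ _).
  have dP : is_derive x (1 : R) (fun y : R => P.[y^-1]) (P^`().[x^-1] * (- 1 * (x^-1 * x^-1))).
    exact: (is_derive_fun_comp (f := fun y : R => y^-1) (is_derive_poly P _) dV).
  have dE : is_derive x (1 : R) (fun y : R => expR (-2 * y^-1))
     (expR (-2 * x^-1) * (0 * x^-1 + -2 * (- 1 * (x^-1 * x^-1)))).
    apply: (is_derive_fun_comp (f := fun y : R => -2 * y^-1) (is_derive_expR _)).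
    exact: is_derive_fun_mul (is_derive_const_fun _ _ _) dV.
  have dPE := is_derive_fun_mul dP dE.
  apply: is_derive_eq (near_eq_is_derive _ dPE) _.
    near=> y; rewrite /flat ifT//.
    by near: y; exact: lt_nbhsr.
  by rewrite /flat_deriv hornerM hornerXn hornerD hornerN hornerMn; ring.
- have -> : flat (flat_deriv P) 0 = 0 by rewrite /flat ltxx.
  have [C C0 hC] := poly_le_exp ('X^2 * P) (ltr0Sn R 0).
  have bound (y : R) : 0 < y -> `|P.[y^-1] * expR (-2 * y^-1)| <= C * y ^+ 2.
    move=> y0; have yV0 : 0 <= y^-1 by rewrite invr_ge0 ltW.
    have h := hC _ yV0.
    rewrite mul1r hornerM hornerXn normrM normrX (ger0_norm yV0) in h.
    rewrite normrM (ger0_norm (expR_ge0 _)) -ler_pdivrMr ?exprn_gt0//.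
    have -> : `|P.[y^-1]| * expR (-2 * y^-1) / y ^+ 2 =
        (y^-1 ^+ 2 * `|P.[y^-1]|) * expR (-2 * y^-1) by rewrite exprVn; ring.
    apply: le_trans (ler_wpM2r (expR_ge0 _) h) _.
    rewrite -mulrA -expRD -[leRHS]mulr1; apply: ler_wpM2l => //.
    by rewrite -[leRHS]expR0 ler_expR; lra.
  apply: (is_derive_quadratic_bound (C := C)); first by rewrite /flat ltxx.
  move=> y; rewrite /flat; case: ifP => [y0|_]; first exact: bound.
  by rewrite normr0 mulr_ge0// sqr_ge0.
Unshelve. all: by end_near.
Qed.

Definition flat_bump (i : nat) : R -> R := flat (iter i flat_deriv 1).

Lemma is_derive_flat_bump i x : is_derive x 1 (flat_bump i) (flat_bump i.+1 x).
Proof. exact: is_derive_flat. Qed.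

Lemma flat_bump_le0 i x : x <= 0 -> flat_bump i x = 0.
Proof. by move=> x0; rewrite /flat_bump /flat ltNge x0. Qed.

Lemma flat_bump_pos x : 0 < x ->
  [/\ flat_bump 0 x = expR (-2 * x^-1),
      flat_bump 1 x = 2 * x^-1 ^+ 2 * flat_bump 0 x &
      flat_bump 2 x = 4 * (x^-1 ^+ 4 - x^-1 ^+ 3) * flat_bump 0 x].
Proof.
move=> x0; rewrite /flat_bump /flat x0 /=.
have -> : flat_deriv 1 = 'X^2 *+ 2.
  by rewrite /flat_deriv derivC subr0 mulrnAr mulr1.
rewrite hornerC mul1r hornerMn hornerXn /flat_deriv derivMn derivXn /=.
by rewrite hornerM hornerD hornerN !hornerMn !hornerXn expr1; split => //; ring.
Qed.

(** Let F(u) = exp(-2/x) with x = 1 - (u/3)^2 and d = dx/du.  The right-hand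
    side is F'' and the claim is F'' >= - F.  With 1/x = 1 + z and z >= 0 this is
      16 z^4 + 32 z^3 + 12 z^2 - 8 z + 5 >= 0,
    where the quadratic part is already positive. *)
Lemma flat_bump_subsolution x (d : R) : 0 < x -> d ^+ 2 = 4 / 9 * (1 - x) ->
  - flat_bump 0 x <= flat_bump 2 x * d ^+ 2 - 2 / 9 * flat_bump 1 x.
Proof.
move=> x0 dE; have [b0 b1 b2] := flat_bump_pos x0.
have g0 : 0 < flat_bump 0 x by rewrite b0 expR_gt0.
have x1 : x <= 1 by have := sqr_ge0 d; rewrite dE; lra.
rewrite b1 b2 dE.
have [z [z0 zE]] : exists z, 0 <= z /\ x^-1 = 1 + z.
  exists (x^-1 - 1); split; last by ring.
  by rewrite subr_ge0 invf_ge1.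
have xE : 1 - x = z / (1 + z).
  by rewrite -[x]invrK zE; field; rewrite gt_eqF// ltr_wpDr.
rewrite xE zE -subr_ge0.
have -> : 4 * ((1 + z) ^+ 4 - (1 + z) ^+ 3) * flat_bump 0 x * (4 / 9 * (z / (1 + z)))
   - 2 / 9 * (2 * (1 + z) ^+ 2 * flat_bump 0 x) - - flat_bump 0 x
  = flat_bump 0 x * ((16 * z ^+ 4 + 32 * z ^+ 3 + 12 * z ^+ 2 - 8 * z + 5) / 9).
  by field; rewrite gt_eqF// ltr_wpDr.
apply: mulr_ge0; first exact: ltW.
by nra.
Qed.

End FlatFunctions.

(** * Radial test functions *)

Section TestFunction.
Context {R : realType} (m mu : R).
Local Notation q := ((m - 1) / 2).

(** log tan(t/2) as a function of cos t. *)
Definition log_height (c : R) : R := (ln (1 - c) - ln (1 + c)) / 2.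
(** Positive exactly on an interval of length 6 around [mu] in the variable
    u = log tan(t/2). *)
Definition window (c : R) : R := 1 - ((log_height c - mu) / 3) ^+ 2.
(** sin^(2 - q) times the bump, as a function of cos t, with q = (m - 1) / 2. *)
Definition test_chi (c : R) : R :=
  expR ((1 - q / 2) * ln (1 - c * c)) * flat_bump 0 (window c).

Lemma is_derive_log_height (c : R) : -1 < c < 1 ->
  is_derive c 1 log_height (- (1 - c * c)^-1).
Proof.
move=> /andP[c1 c2].
have p1 : 0 < 1 - c by lra.
have p2 : 0 < 1 + c by lra.
have l1 : is_derive c (1 : R) (fun y : R => 1 + -1 * y) (0 + (0 * c + -1 * 1)).
  have h := is_derive_fun_mul (is_derive_const_fun (-1) c (1 : R)) (is_derive_id c 1).
  exact: (is_derive_fun_add (is_derive_const_fun 1 c (1 : R)) h).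
have l2 : is_derive c (1 : R) (fun y : R => 1 + y) (0 + 1).
  exact: (is_derive_fun_add (is_derive_const_fun 1 c (1 : R)) (is_derive_id c 1)).
have d1 : is_derive c (1 : R) (fun y : R => ln (1 + -1 * y))
    ((1 - c)^-1 * (0 + (0 * c + -1 * 1))).
  apply: (is_derive_fun_comp (f := fun y : R => 1 + -1 * y) _ l1).
  by rewrite mulN1r; exact: is_derive1_ln.
have d2 : is_derive c (1 : R) (fun y : R => ln (1 + y)) ((1 + c)^-1 * (0 + 1)).
  apply: (is_derive_fun_comp (f := fun y : R => 1 + y) _ l2).
  exact: is_derive1_ln.
have -> : log_height = fun y : R => (ln (1 + -1 * y) + -1 * ln (1 + y)) * 2^-1.
  by apply/funext => y; rewrite /log_height !mulN1r.
have d := is_derive_fun_mul (is_derive_fun_add d1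
  (is_derive_fun_mul (is_derive_const_fun (-1) c (1 : R)) d2))
  (is_derive_const_fun 2^-1 c (1 : R)).
apply: is_derive_eq d _.
have p3 : 1 - c * c != 0.
  have -> : 1 - c * c = (1 - c) * (1 + c) by ring.
  by rewrite mulf_neq0// gt_eqF.
by field; rewrite p3 !gt_eqF.
Qed.

Section AlongGeodesic.
Variable t : R.
Hypothesis t0 : 0 < sin t.

Lemma cos_interior : -1 < cos t < 1.
Proof.
have := cos2Dsin2 t; have : 0 < sin t ^+ 2 by rewrite exprn_gt0.
by move=> h1 h2; apply/andP; split; nra.
Qed.

Lemma is_derive_log_height_cos :
  is_derive t 1 (fun y : R => log_height (cos y)) (sin t)^-1.
Proof.
have h := is_derive_fun_comp (is_derive_log_height cos_interior) (is_derive_cos t).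
apply: is_derive_eq h _.
have -> : 1 - cos t * cos t = sin t ^+ 2 by have := cos2Dsin2 t; lra.
by have := lt0r_neq0 t0; move: (sin t) => s s0; field.
Qed.

Lemma is_derive_window_cos :
  is_derive t 1 (fun y : R => window (cos y))
    (- (2 / 9) * (log_height (cos t) - mu) / sin t).
Proof.
have -> : (fun y : R => window (cos y)) = fun y : R =>
    1 + - 9^-1 * ((log_height (cos y) + - mu) * (log_height (cos y) + - mu)).
  by apply/funext => y; rewrite /window; field.
have du := is_derive_fun_add is_derive_log_height_cos
  (is_derive_const_fun (- mu) t (1 : R)).
have d := is_derive_fun_add (is_derive_const_fun 1 t (1 : R))
  (is_derive_fun_mul (is_derive_const_fun (- 9^-1) t (1 : R))
  (is_derive_fun_mul du du)).
by apply: is_derive_eq d _; field; exact: lt0r_neq0.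
Qed.

End AlongGeodesic.

(** The derivative of the window with respect to u. *)
Definition slope (t : R) : R := - (2 / 9) * (log_height (cos t) - mu).
Definition profile (i : nat) (t : R) : R := flat_bump i (window (cos t)).
Definition weight (t : R) : R := expR (- q * ln (sin t)).

Definition test_phi (t : R) : R := weight t * profile 0 t.
Definition test_phi1 (t : R) : R :=
  weight t * (sin t)^-1 * (profile 1 t * slope t - q * cos t * profile 0 t).
Definition test_phi2 (t : R) : R :=
  weight t * ((sin t)^-1 * (sin t)^-1) *
  (profile 2 t * slope t ^+ 2 - 2 / 9 * profile 1 t + q * sin t ^+ 2 * profile 0 t
   - q * cos t * (profile 1 t * slope t)
   - (q + 1) * cos t * (profile 1 t * slope t - q * cos t * profile 0 t)).

Lemma is_derive_profile i t : 0 < sin t ->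
  is_derive t 1 (profile i) (profile i.+1 t * (slope t / sin t)).
Proof.
move=> t0; have d := is_derive_fun_comp (f := fun y : R => window (cos y)) (is_derive_flat_bump i (window (cos t)))
  (is_derive_window_cos t0).
by apply: is_derive_eq d _; rewrite /slope mulrA.
Qed.

Lemma is_derive_slope t : 0 < sin t -> is_derive t 1 slope (- (2 / 9) / sin t).
Proof.
move=> t0; have d := is_derive_fun_mul (is_derive_const_fun (- (2 / 9)) t (1 : R))
  (is_derive_fun_add (is_derive_log_height_cos t0)
    (is_derive_const_fun (- mu) t (1 : R))).
by apply: is_derive_eq d _; ring.
Qed.

Lemma is_derive_weight t : 0 < sin t ->
  is_derive t 1 weight (- q * (cos t / sin t) * weight t).
Proof.
move=> t0.
have dl : is_derive t (1 : R) (fun y : R => - q * ln (sin y))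
    (0 * ln (sin t) + - q * ((sin t)^-1 * cos t)).
  apply: is_derive_fun_mul (is_derive_const_fun _ _ _) _.
  exact: (is_derive_fun_comp (is_derive1_ln t0) (is_derive_sin t)).
have d := is_derive_fun_comp (f := fun y : R => - q * ln (sin y)) (is_derive_expR _) dl.
by apply: is_derive_eq d _; rewrite /weight; ring.
Qed.

Lemma is_derive_test_phi t : 0 < sin t -> is_derive t 1 test_phi (test_phi1 t).
Proof.
move=> t0; have d := is_derive_fun_mul (is_derive_weight t0) (is_derive_profile 0 t0).
by apply: is_derive_eq d _; rewrite /test_phi1; field; exact: lt0r_neq0.
Qed.

Lemma is_derive_test_phi1 t : 0 < sin t -> is_derive t 1 test_phi1 (test_phi2 t).
Proof.
move=> t0; have s0 := lt0r_neq0 t0.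
have d := is_derive_fun_mul (is_derive_fun_mul (is_derive_weight t0)
    (is_derive_fun_inv s0 (is_derive_sin t)))
  (is_derive_fun_add (is_derive_fun_mul (is_derive_profile 1 t0) (is_derive_slope t0))
    (is_derive_fun_mul (is_derive_const_fun (-1) t (1 : R))
     (is_derive_fun_mul (is_derive_fun_mul (is_derive_const_fun q t (1 : R))
       (is_derive_cos t)) (is_derive_profile 0 t0)))).
have -> : test_phi1 = fun y : R => weight y * (sin y)^-1 *
    (profile 1 y * slope y + -1 * (q * cos y * profile 0 y)).
  by apply/funext => y; rewrite mulN1r.
apply: is_derive_eq d _; rewrite /test_phi2.
by field.
Qed.

Lemma test_chi_cos t : 0 < sin t -> test_chi (cos t) = sin t ^+ 2 * test_phi t.
Proof.
move=> t0; rewrite /test_chi /test_phi /weight -/(profile 0 t) mulrA; congr (_ * _).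
have -> : 1 - cos t * cos t = sin t * sin t by have := cos2Dsin2 t; lra.
have -> : sin t ^+ 2 = expR (2 * ln (sin t)).
  by rewrite expRM_natl lnK ?posrE.
rewrite lnM ?posrE// -expRD; congr expR; by field.
Qed.

(** The conjugation phi = sin^(-q) psi(u) removes the first-order term exactly
    for q = (m - 1) / 2, since d/dt = (1/sin) d/du. *)
Lemma lichnerowicz_test n t : 0 < sin t -> n%:R = m + 1 ->
  lichnerowicz_radial (n := n) test_phi test_phi1 test_phi2 t =
  weight t * ((sin t)^-1 * (sin t)^-1) *
  (- (profile 2 t * slope t ^+ 2 - 2 / 9 * profile 1 t)
   + (q ^+ 2 - 2 * (m - 1) + (2 * m - q - q ^+ 2) * sin t ^+ 2) * profile 0 t).
Proof.
move=> t0 nE; rewrite /lichnerowicz_radial nE /test_phi /test_phi1 /test_phi2.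
have s0 := lt0r_neq0 t0; have := cos2Dsin2 t => e.
have c2 : cos t ^+ 2 = 1 - sin t ^+ 2 by rewrite -e addrK.
move: (profile 0 t) (profile 1 t) (profile 2 t) (slope t) (weight t) => g0 g1 g2 d w.
transitivity (w * ((sin t)^-1 * (sin t)^-1) *
  (- (g2 * d ^+ 2 - 2 / 9 * g1)
   + (q ^+ 2 * cos t ^+ 2 - q * sin t ^+ 2 + 2 * m * sin t ^+ 2 - 2 * (m - 1)) * g0)).
  by move: s0; clear; move: (sin t) (cos t) => s c s0; field.
by rewrite c2; ring.
Qed.

Lemma profile_outside i t : window (cos t) <= 0 -> profile i t = 0.
Proof. exact: flat_bump_le0. Qed.

Hypotheses (m4 : 4 <= m) (m8 : m <= 8) (muN : mu <= -20).

(** On the support u <= -17, and sin = 1 / cosh u. *)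
Lemma sin_small t : 0 < sin t -> 0 < window (cos t) -> sin t ^+ 2 <= 4 / 35.
Proof.
move=> t0 wt; have /andP[c1 c2] := cos_interior t0.
have hl : log_height (cos t) < -17.
  move: wt; rewrite /window; move: (log_height _) => h wt.
  rewrite ltNge; apply/negP => h17.
  have h1 : 1 <= (h - mu) / 3.
    by move: h17 muN; lra.
  by have := ler_pM ler01 ler01 h1 h1; move: wt; rewrite expr2; lra.
have p1 : 0 < 1 - cos t by lra.
have p2 : 0 < 1 + cos t by lra.
have e : 1 - cos t = (1 + cos t) * expR (2 * log_height (cos t)).
  have -> : 2 * log_height (cos t) = ln (1 - cos t) - ln (1 + cos t).
    by rewrite /log_height; field.
  by rewrite expRD expRN !lnK ?posrE// mulrC divfK// gt_eqF.
have E1 : expR (2 * log_height (cos t)) <= 35^-1.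
  apply: (@le_trans _ _ (expR (- 34))); first by rewrite ler_expR; lra.
  rewrite expRN lef_pV2 ?posrE ?expR_gt0//.
  by apply: le_trans (expR_ge1Dx _); lra.
have E0 := expR_gt0 (2 * log_height (cos t)).
have s2 : sin t ^+ 2 = (1 - cos t) * (1 + cos t).
  by have := cos2Dsin2 t; lra.
rewrite s2; move: e E0 E1; move: (expR _) => E e E0 E1.
have : 1 - cos t <= 2 / 35 by rewrite e; nra.
by nra.
Qed.

(** The coefficient q^2 - 2 (m - 1) = - (m - 1)(9 - m) / 4 is at most -7/4 for
    4 <= m <= 8.  The correction of order sin^2 is too small to raise it above -1,
    so it beats the bound psi'' >= - psi. *)
Lemma lichnerowicz_test_lt0 n t : 0 < sin t -> n%:R = m + 1 ->
  0 < window (cos t) ->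
  lichnerowicz_radial (n := n) test_phi test_phi1 test_phi2 t * test_phi t < 0.
Proof.
move=> t0 nE wt; rewrite lichnerowicz_test// /test_phi.
have ss := sin_small t0 wt.
have W0 : 0 < weight t by exact: expR_gt0.
have b0 : 0 < profile 0 t.
  by rewrite /profile; have [-> _ _] := flat_bump_pos wt; exact: expR_gt0.
have sub : - profile 0 t <= profile 2 t * slope t ^+ 2 - 2 / 9 * profile 1 t.
  by apply: flat_bump_subsolution => //; rewrite /slope /window; field.
have gap : q ^+ 2 - 2 * (m - 1) + (2 * m - q - q ^+ 2) * sin t ^+ 2 < -1.
  have s2 := sqr_ge0 (sin t); move: ss s2 m4 m8; move: (sin t ^+ 2) => s h1 h2 ? ?.
  by nra.
rewrite nmulr_rlt0; first by rewrite mulr_gt0.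
rewrite pmulr_rlt0; last by rewrite mulr_gt0// mulr_gt0// invr_gt0.
move: sub gap; move: (profile 2 t * _ - _) (_ + _ * sin t ^+ 2) => A B sub gap.
by nra.
Qed.

End TestFunction.

(** * Negativity of the radial integral *)

Section NegativeIntegral.
Context {R : realType}.
Local Notation mu := (@lebesgue_measure R).

Lemma Rintegral_lt0 (a b p : R) (F : R -> R) :
  continuous F -> (forall t, a < t < b -> F t <= 0) -> a < p < b -> F p < 0 ->
  \int[mu]_(t in `]a, b[) F t < 0.
Proof.
move=> cF F0 /andP[ap pb] Fp.
have iF : mu.-integrable `]a, b[ (EFin \o F).
  have iE : mu.-integrable `[a, b] (EFin \o F).
    apply: continuous_compact_integrable; first exact: segment_compact.
    exact: continuous_subspaceT.
  by apply: integrableS iE => //; apply: subset_itv; rewrite bnd_simp.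
have iN : mu.-integrable `]a, b[ (EFin \o (fun t => - F t)).
  by have := integrableN iF; apply: eq_integrable.
have [e e0 eF] : exists2 e, 0 < e & forall t, `|p - t| < e -> F t < F p / 2.
  have : \forall t \near p, F t < F p / 2.
    by apply: (cvgr_lt _ (cF p)); lra.
  by move=> /nbhs_ballP[e e0 h]; exists e => // t pt; exact: h.
(* Half distances keep [p, p + d] inside ]a, b[ and where F < F p / 2. *)
pose d := Num.min (e / 2) (Num.min ((p - a) / 2) ((b - p) / 2)).
have d0 : 0 < d by rewrite !lt_min !divr_gt0 ?subr_gt0.
have [de [da db]] : d <= e / 2 /\ d <= (p - a) / 2 /\ d <= (b - p) / 2.
  by rewrite !ge_min !lexx !orbT.
have lower : - F p / 2 * (p + d - p) <= \int[mu]_(t in `]a, b[) (- F t).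
  apply: Rintegral_ge_itv => //.
  - by move=> s; rewrite /= in_itv/= => /F0; rewrite oppr_ge0.
  - move=> s; rewrite /= !in_itv/= => /andP[h1 h2]; apply/andP; split; lra.
  - by lra.
  - move=> s; rewrite in_itv/= => /andP[h1 h2].
    have := eF s; rewrite ltr_norml; move=> h.
    have : F s < F p / 2 by apply: h; apply/andP; split; lra.
    lra.
have pos : 0 < - F p / 2 * (p + d - p).
  by apply: mulr_gt0; lra.
have -> : \int[mu]_(t in `]a, b[) F t = - 1 * \int[mu]_(t in `]a, b[) (- F t).
  rewrite -RintegralZl//; apply: eq_Rintegral => t _.
  by rewrite mulN1r opprK.
lra.
Qed.

End NegativeIntegral.

(** * Smoothness and supports of the test functions *)

Section TestFunctionSmoothness.
Context {R : realType} (m : R).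

Lemma smooth_fun_expR d (U : set 'rV[R]_d) f :
  smooth_fun U f -> smooth_fun U (fun p => expR (f p)).
Proof.
by move=> sf; apply: (@smooth_comp _ _ _ (fun _ => @expR R) setT f 0).
Qed.

(** The derivatives of ln are polynomials in 1/x. *)
Fixpoint ln_deriv_poly (n : nat) : {poly R} :=
  match n with 0%N => 'X | n'.+1 => - ('X^2 * (ln_deriv_poly n')^`()) end.

Lemma smooth_fun_ln d (U : set 'rV[R]_d) f :
  smooth_fun U f -> (forall p, U p -> 0 < f p) -> smooth_fun U (fun p => ln (f p)).
Proof.
move=> sf f0.
apply: (@smooth_comp _ _ _ (fun n => if n is n'.+1 then fun x : R =>
  (ln_deriv_poly n').[x^-1] else @ln R) [set x : R | 0 < x] f 0) => //.
move=> [|n] x /= x0; first by rewrite hornerX; exact: is_derive1_ln.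
have xn0 : x != 0 by rewrite gt_eqF.
have dV := is_derive_fun_inv xn0 (is_derive_id x (1 : R)).
have d0 := is_derive_fun_comp (f := fun y : R => y^-1)
  (is_derive_poly (ln_deriv_poly n) _) dV.
by apply: is_derive_eq d0 _; rewrite hornerN hornerM hornerXn; ring.
Qed.

Lemma smooth_test_chi mu : smooth_on_interval (test_chi m mu).
Proof.
move=> d U f sf f1.
have sc c : smooth_fun U (fun=> c : R) by exact: smooth_cst.
have p1 p : U p -> 0 < 1 + -1 * f p by move=> /f1; lra.
have p2 p : U p -> 0 < 1 + f p by move=> /f1; lra.
have s1 : smooth_fun U (fun p => 1 + -1 * f p).
  by apply: smooth_add => //; exact: smooth_mul.
have s2 : smooth_fun U (fun p => 1 + f p) by exact: smooth_add.
have sl : smooth_fun U (fun p => (ln (1 + -1 * f p) + -1 * ln (1 + f p)) * 2^-1).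
  apply: smooth_mul => //; apply: smooth_add; first exact: smooth_fun_ln.
  by apply: smooth_mul => //; exact: smooth_fun_ln.
have sw : smooth_fun U (fun p => 1 + - 9^-1 *
    (((ln (1 + -1 * f p) + -1 * ln (1 + f p)) * 2^-1 + - mu)
   * ((ln (1 + -1 * f p) + -1 * ln (1 + f p)) * 2^-1 + - mu))).
  apply: smooth_add => //; apply: smooth_mul => //.
  by apply: smooth_mul; exact: smooth_add.
have -> : (fun p => test_chi m mu (f p)) = fun p =>
    expR ((1 - (m - 1) / 2 / 2) * ln (1 + -1 * (f p * f p))) *
    flat_bump 0 (1 + - 9^-1 *
    (((ln (1 + -1 * f p) + -1 * ln (1 + f p)) * 2^-1 + - mu)
   * ((ln (1 + -1 * f p) + -1 * ln (1 + f p)) * 2^-1 + - mu))).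
  apply/funext => p; rewrite /test_chi /window /log_height !mulN1r.
  by congr (_ * flat_bump 0 _); field.
apply: smooth_mul.
  apply: smooth_fun_expR; apply: smooth_mul => //; apply: smooth_fun_ln.
    by apply: smooth_add => //; apply: smooth_mul => //; exact: smooth_mul.
  move=> p Up; have := p1 _ Up; have := p2 _ Up; move: (f p) => x h1 h2.
  by nra.
apply: (@smooth_comp _ _ _ (@flat_bump R) setT _ 0) => //.
by move=> n x _; exact: is_derive_flat_bump.
Qed.

Lemma window_le0 (mu c : R) : 3 <= `|log_height c - mu| -> window mu c <= 0.
Proof.
move=> h; rewrite /window subr_le0 -[X in X <= _](expr1n R 2).
rewrite -[leRHS]real_normK ?num_real// lerXn2r ?nnegrE//.
by rewrite normrM (@ger0_norm _ (3^-1)) ?invr_ge0// ler_pdivlMr// mul1r.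
Qed.

(** Heights near 1 and -1 correspond to u near -oo and +oo.  At the end points
    themselves the logarithm of 0 takes the value 0, so that u is -(ln 2)/2 or
    (ln 2)/2, again far from [mu].  The bound depends on [nu] only, hence serves
    all centers above [nu]. *)
Lemma window_ends (mu nu c : R) : mu <= -20 -> nu <= mu ->
  1 - expR (2 * (nu - 3)) < `|c| <= 1 -> window mu c <= 0.
Proof.
move=> mu20 numu /andP[rc c1]; apply: window_le0.
have E1 : expR (2 * (nu - 3)) < 1 by rewrite expR_lt1; lra.
have E0 := expR_gt0 (2 * (nu - 3)).
move: rc c1; rewrite /log_height.
case: (lerP 0 c) => [c0|c0].
  rewrite ger0_norm// => rc c1.
  have l2 : 0 <= ln (1 + c) by apply: ln_ge0; lra.
  case: (ltP c 1) => [c1'|c1'].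
    have : ln (1 - c) <= ln (expR (2 * (nu - 3))).
      by rewrite ler_ln ?posrE//; lra.
    rewrite expRK => l1; rewrite ler0_norm; lra.
  have -> : c = 1 by lra.
  rewrite subrr ln0// sub0r.
  have l3 : ln (1 + 1 : R) <= 1 by apply: le_ln1Dx; lra.
  by rewrite ger0_norm; lra.
rewrite ltr0_norm// => rc c1.
have l1 : 0 <= ln (1 - c) by apply: ln_ge0; lra.
have l2 : ln (1 + c) <= 0 by apply: ln_le0; lra.
by rewrite ger0_norm; lra.
Qed.

Lemma windows_disjoint (mu nu c : R) : 20 <= `|mu - nu| ->
  0 < window mu c -> window nu c <= 0.
Proof.
move=> mn; case: (lerP 3 `|log_height c - mu|) => [/window_le0|h _].
  by rewrite leNgt => /negP.
apply: window_le0; have := ler_distD (log_height c) mu nu.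
by rewrite [`|mu - log_height c|]distrC; move: mn h; lra.
Qed.

Lemma exists_center (mu : R) :
  exists2 t : R, 0 < t < pi & window mu (cos t) = 1.
Proof.
(* Solving (1 - c) / (1 + c) = E for c = cos t. *)
pose E := expR (2 * mu); have E0 : 0 < E by exact: expR_gt0.
pose c := (1 - E) / (1 + E).
have c1 : -1 < c by rewrite ltr_pdivlMr; lra.
have c2 : c < 1 by rewrite ltr_pdivrMr; lra.
exists (acos c); first by rewrite acos_gt0 ?acos_ltpi ?c1 ?c2 ?ltW.
rewrite acosK; last by rewrite in_itv/= !ltW.
rewrite /window /log_height.
have -> : 1 - c = E * (1 + c) by rewrite /c; field; lra.
have p2 : 0 < 1 + c by lra.
rewrite lnM ?posrE// /E expRK.
have -> : (2 * mu + ln (1 + c) - ln (1 + c)) / 2 - mu = 0 by field.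
by rewrite mul0r expr0n subr0.
Qed.

(** The integrand of the quadratic form of one test function, without the factor
    sin^(k + l), in a form that is visibly continuous. *)
Definition energy (mu t : R) : R :=
  weight m t * ((sin t)^-1 * (sin t)^-1) *
  (- (profile mu 2 t * slope mu t ^+ 2 - 2 / 9 * profile mu 1 t)
   + (((m - 1) / 2) ^+ 2 - 2 * (m - 1)
      + (2 * m - (m - 1) / 2 - ((m - 1) / 2) ^+ 2) * sin t ^+ 2) * profile mu 0 t)
  * test_phi m mu t.

Lemma energy_continuous mu t : 0 < sin t -> {for t, continuous (energy mu)}.
Proof.
move=> t0; have s0 : sin t != 0 by rewrite gt_eqF.
have dc c := is_derive_const_fun c t (1 : R).
have dw := is_derive_weight m t0.
have ds := is_derive_sin t.
have dsi := is_derive_fun_inv s0 ds.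
have db i := is_derive_profile mu i t0.
have dsl := is_derive_slope mu t0.
have d := is_derive_fun_mul (is_derive_fun_mul
  (is_derive_fun_mul dw (is_derive_fun_mul dsi dsi))
  (is_derive_fun_add
    (is_derive_fun_mul (dc (-1)) (is_derive_fun_add
      (is_derive_fun_mul (db 2%N) (is_derive_fun_mul dsl dsl))
      (is_derive_fun_mul (dc (- (2 / 9))) (db 1%N))))
    (is_derive_fun_mul (is_derive_fun_add
       (dc (((m - 1) / 2) ^+ 2 - 2 * (m - 1)))
       (is_derive_fun_mul (dc (2 * m - (m - 1) / 2 - ((m - 1) / 2) ^+ 2))
         (is_derive_fun_mul ds ds))) (db 0%N))))
  (is_derive_test_phi m mu t0).
apply: differentiable_continuous; apply/derivable1_diffP.
have [d1 _] := d.
apply: (eq_ind _ (fun f => derivable f t 1) d1); apply/funext => y.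
rewrite /energy; move: (sin y)^-1 (sin y) (profile mu 0 y) (profile mu 1 y)
  (profile mu 2 y) (slope mu y) (weight m y) (test_phi m mu y) => *.
by ring.
Qed.

Lemma energy_outside mu t : window mu (cos t) <= 0 -> energy mu t = 0.
Proof. by move=> w0; rewrite /energy /test_phi (profile_outside 0 w0) !mulr0. Qed.

Hypotheses (m4 : 4 <= m) (m8 : m <= 8).

Lemma energyE n mu t : 0 < sin t -> n%:R = m + 1 ->
  lichnerowicz_radial (n := n) (test_phi m mu) (test_phi1 m mu) (test_phi2 m mu) t
    * test_phi m mu t = energy mu t.
Proof. by move=> t0 nE; rewrite lichnerowicz_test. Qed.

Lemma energy_lt0 n mu t : n%:R = m + 1 -> mu <= -20 -> 0 < sin t ->
  0 < window mu (cos t) -> energy mu t < 0.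
Proof. by move=> nE mu20 t0 wt; rewrite -(energyE mu t0 nE) lichnerowicz_test_lt0. Qed.

End TestFunctionSmoothness.

(** * The space of negative directions *)

Section NegativeDirections.
Context {R : realType} (M : model) (k l N : nat).
Hypotheses (k2 : (2 <= k)%N) (l2 : (2 <= l)%N) (kl8 : (k + l <= 8)%N).
Local Notation m := ((k + l)%:R : R).
Implicit Types (a : 'I_N -> R) (t c : R).

(** Centers 20 apart keep the intervals of radius 3 disjoint and deep in the
    region where sin is small. *)
Definition center (j : 'I_N) : R := -20 * (j.+1)%:R.

Definition combined_chi a c : R := \sum_j a j * test_chi m (center j) c.
Definition combined_phi a t : R := \sum_j a j * test_phi m (center j) t.
Definition combined_phi1 a t : R := \sum_j a j * test_phi1 m (center j) t.
Definition combined_phi2 a t : R := \sum_j a j * test_phi2 m (center j) t.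
Definition combined_energy a t : R :=
  \sum_j a j ^+ 2 * energy m (center j) t.

Lemma center_le j : center j <= -20.
Proof.
have : (1 : R) <= (j.+1)%:R by rewrite (ler_nat R 1).
by rewrite /center; lra.
Qed.

Lemma center_ge j : -20 * N%:R <= center j.
Proof.
have : (j.+1)%:R <= N%:R :> R by rewrite ler_nat.
by rewrite /center; lra.
Qed.

Lemma center_apart i j : i != j -> 20 <= `|center i - center j|.
Proof.
move=> ij; have [h|h] : (i < j)%N \/ (j < i)%N.
- by apply/orP; rewrite -neq_ltn.
- have : (i.+2)%:R <= (j.+1)%:R :> R by rewrite ler_nat.
  rewrite /center -[(i.+2)%:R]natr1 => h2.
  by rewrite ger0_norm; lra.
- have : (j.+2)%:R <= (i.+1)%:R :> R by rewrite ler_nat.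
  rewrite /center -[(j.+2)%:R]natr1 => h2.
  by rewrite ler0_norm; lra.
Qed.

Lemma dimension_bounds : 4 <= m /\ m <= 8.
Proof.
split; last by rewrite (ler_nat R _ 8).
by rewrite (ler_nat R 4) (leq_add k2 l2).
Qed.

Lemma dimensionE : ((1 + k) + l)%:R = m + 1 :> R.
Proof. by rewrite -addnA addnC natrD. Qed.

Lemma smooth_combined_chi a : smooth_on_interval (combined_chi a).
Proof.
move=> d U f sf f1; apply: smooth_fun_sum => j.
by apply: smooth_mul; [exact: smooth_cst|exact: smooth_test_chi].
Qed.

Lemma combined_window_ends c j :
  1 - expR (2 * (-20 * N%:R - 3)) < `|c| <= 1 -> window (center j) c <= 0.
Proof. by apply: window_ends; [exact: center_le|exact: center_ge]. Qed.

Lemma combined_chi_ends a : vanishes_near_ends (combined_chi a).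
Proof.
exists (1 - expR (2 * (-20 * N%:R - 3))).
  by have := expR_gt0 (2 * (-20 * N%:R - 3 : R)); lra.
move=> c hc; rewrite /combined_chi big1// => j _.
by rewrite /test_chi flat_bump_le0 ?mulr0//; exact: combined_window_ends.
Qed.

Lemma combined_chi_cos a t : 0 < sin t ->
  combined_chi a (cos t) = sin t ^+ 2 * combined_phi a t.
Proof.
move=> t0; rewrite /combined_chi /combined_phi mulr_sumr.
by apply: eq_bigr => j _; rewrite test_chi_cos// mulrCA.
Qed.

Lemma is_derive_combination (f f' : 'I_N -> R -> R) a t :
  (forall j, is_derive t 1 (f j) (f' j t)) ->
  is_derive t 1 (fun y : R => \sum_j a j * f j y) (\sum_j a j * f' j t).
Proof.
move=> df; have d j : is_derive t (1 : R) (fun y : R => a j * f j y) (a j * f' j t).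
  have d := is_derive_fun_mul (is_derive_const_fun (a j) t (1 : R)) (df j).
  by rewrite mul0r add0r in d.
exact: is_derive_fun_sum d.
Qed.

Lemma is_derive_combined_phi a t : 0 < sin t ->
  is_derive t 1 (combined_phi a) (combined_phi1 a t).
Proof.
move=> t0; exact: (is_derive_combination (f := fun j => test_phi m (center j))
  (f' := fun j => test_phi1 m (center j)) a
  (fun j => is_derive_test_phi m (center j) t0)).
Qed.

Lemma is_derive_combined_phi1 a t : 0 < sin t ->
  is_derive t 1 (combined_phi1 a) (combined_phi2 a t).
Proof.
move=> t0; exact: (is_derive_combination (f := fun j => test_phi1 m (center j))
  (f' := fun j => test_phi2 m (center j)) a
  (fun j => is_derive_test_phi1 m (center j) t0)).
Qed.

(** Where one test function is nonzero the others vanish together with their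
    derivatives, so that all products of different indices are 0. *)
Lemma combined_energyE a t : 0 < sin t ->
  lichnerowicz_radial (n := (1 + k) + l) (combined_phi a) (combined_phi1 a)
    (combined_phi2 a) t * combined_phi a t = combined_energy a t.
Proof.
move=> t0.
pose L j := lichnerowicz_radial (n := (1 + k) + l) (test_phi m (center j))
  (test_phi1 m (center j)) (test_phi2 m (center j)) t.
have LE : lichnerowicz_radial (n := (1 + k) + l) (combined_phi a)
    (combined_phi1 a) (combined_phi2 a) t = \sum_j a j * L j.
  rewrite /lichnerowicz_radial /combined_phi /combined_phi1 /combined_phi2.
  rewrite !mulr_sumr -!sumrN -!big_split/=; apply: eq_bigr => j _.
  by rewrite /L /lichnerowicz_radial; ring.
have cross i j : i != j -> L i * test_phi m (center j) t = 0.
  move=> ij; case: (lerP (window (center i) (cos t)) 0) => wi.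
    by rewrite /L lichnerowicz_test ?dimensionE// !profile_outside//; ring.
  have wj := windows_disjoint (center_apart ij) wi.
  by rewrite /test_phi profile_outside// !mulr0.
rewrite LE /combined_phi mulr_suml; apply: eq_bigr => i _.
rewrite mulr_sumr (bigD1 i)//= big1 => [|j ji].
  by rewrite addr0 -(energyE (center i) t0 dimensionE) -/(L i); ring.
by rewrite mulrACA cross ?mulr0// eq_sym.
Qed.

Lemma combined_energy_ends a t :
  1 - expR (2 * (-20 * N%:R - 3)) < `|cos t| -> combined_energy a t = 0.
Proof.
move=> ct; rewrite /combined_energy big1// => j _.
rewrite energy_outside ?mulr0//; apply: combined_window_ends.
by rewrite ct ler_norml cos_geN1 cos_le1.
Qed.

(** The integrand extended by 0, in order to have a continuous function on the
    whole line. *)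
Definition radial_density a t : R :=
  if 0 < sin t then combined_energy a t * sin t ^+ (k + l) else 0.

(** Where |cos t| is close to 1 the density vanishes identically; elsewhere
    sin t is nonzero and the density is locally 0 or an explicit expression. *)
Lemma radial_density_continuous a : continuous (radial_density a).
Proof.
move=> t; set r := 1 - expR (2 * (-20 * N%:R - 3)) : R.
have r1 : r < 1 by have := expR_gt0 (2 * (-20 * N%:R - 3) : R); rewrite /r; lra.
have transfer (F : R -> R) : (\forall s \near t, F s = radial_density a s) ->
    {for t, continuous F} -> {for t, continuous (radial_density a)}.
  move=> nearF cF; rewrite /prop_for /continuous_at -(nbhs_singleton nearF).
  by apply: cvg_trans cF; apply: near_eq_cvg.
have locally_zero : (\forall s \near t, 0 = radial_density a s) ->
    {for t, continuous (radial_density a)}.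
  by move/(transfer (fun=> 0)); apply; exact: cst_continuous.
have cs : {for t, continuous (@sin R)} by exact: continuous_sin.
have cc : {for t, continuous (fun s : R => `|cos s|)}.
  apply: (@continuous_comp _ _ _ (@cos R) (fun x : R => `|x|)).
    exact: continuous_cos.
  exact: norm_continuous.
case: (ltP r `|cos t|) => [rt|tr].
  apply: locally_zero; have : \forall s \near t, r < `|cos s|.
    exact: (cvgr_gt _ cc).
  apply: filterS => s rs; rewrite /radial_density combined_energy_ends//.
  by rewrite mul0r if_same.
have s0 : sin t != 0.
  apply/eqP => s0; have := cos2Dsin2 t; rewrite s0 expr0n addr0 => c1.
  have : `|cos t| ^+ 2 = 1 by rewrite real_normK ?num_real.
  by have := normr_ge0 (cos t); nra.
case: (ltgtP (sin t) 0) => [st|st|/eqP]; last by rewrite (negbTE s0).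
  apply: locally_zero; have : \forall s \near t, sin s < 0.
    exact: (cvgr_lt _ cs).
  by apply: filterS => s /ltW ss; rewrite /radial_density ltNge ss.
pose F s := combined_energy a s * sin s ^+ (k + l).
have nearF : \forall s \near t, F s = radial_density a s.
  have : \forall s \near t, 0 < sin s by exact: (cvgr_gt _ cs).
  by apply: filterS => s ss; rewrite /radial_density ss.
have cF : {for t, continuous F}.
  apply: cvgM.
    rewrite /combined_energy; apply: cvg_big => [|j _]; first exact: add_continuous.
    by apply: cvgM; [exact: cvg_cst|exact: energy_continuous].
  apply: (@continuous_comp _ _ _ (@sin R) (fun x => x ^+ (k + l))) => //.
  exact: exprn_continuous.
exact: transfer nearF cF.
Qed.

Lemma combined_energy_le0 a t : 0 < sin t -> combined_energy a t <= 0.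
Proof.
move=> t0; have [m4 m8] := dimension_bounds.
apply: sumr_le0 => j _; apply: mulr_ge0_le0; first exact: sqr_ge0.
case: (lerP (window (center j) (cos t)) 0) => wj; first by rewrite energy_outside.
exact: ltW (energy_lt0 m4 m8 dimensionE (center_le j) t0 wj).
Qed.

Lemma split_field_TT0 a : TT0 R M k l (split_field M k l (combined_chi a)).
Proof.
split.
- exact: split_field_symmetric.
- by apply: split_field_smooth; [exact: smooth_combined_chi|exact: combined_chi_ends].
- by apply: split_field_vanishes; exact: combined_chi_ends.
- apply: (split_field_TT _ k2 l2 (phi := combined_phi a)
    (phi1 := combined_phi1 a)) => t t0.
    exact: combined_chi_cos.
  exact: is_derive_combined_phi.
Qed.

Lemma Q_c_combined : exists2 C : R, 0 < C & forall a,
  Q_c R M k l (split_field M k l (combined_chi a)) =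
  \int[@lebesgue_measure R]_(t in `]0, pi[) (C * radial_density a t).
Proof.
have [C C0 QE] := @Q_c_split_field R M k l k2 l2; exists C => // a.
rewrite (QE _ _ _ _ (combined_chi_cos a) (is_derive_combined_phi a)
  (is_derive_combined_phi1 a)).
apply: eq_Rintegral => t; rewrite inE/= in_itv/= => /sin_gt0_pi t0.
by rewrite /radial_density t0 combined_energyE.
Qed.

Lemma Q_c_combined_lt0 a j : a j != 0 ->
  Q_c R M k l (split_field M k l (combined_chi a)) < 0.
Proof.
move=> aj; have [C C0 ->] := Q_c_combined; have [m4 m8] := dimension_bounds.
have [p p0pi wp] := exists_center (center j).
have sp := sin_gt0_pi p0pi.
apply: (Rintegral_lt0 (p := p)) => //.
- move=> t; apply: cvgM; first exact: cvg_cst.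
  exact: radial_density_continuous.
- move=> t /sin_gt0_pi t0; rewrite /radial_density t0.
  apply: mulr_ge0_le0; first exact: ltW.
  apply: mulr_le0_ge0; first exact: combined_energy_le0.
  by rewrite exprn_ge0// ltW.
rewrite /radial_density sp pmulr_rlt0// pmulr_llt0 ?exprn_gt0//.
rewrite /combined_energy (bigD1 j)//= ltr_wnDr//.
  apply: sumr_le0 => i _; apply: mulr_ge0_le0; first exact: sqr_ge0.
  case: (lerP (window (center i) (cos p)) 0) => wi; first by rewrite energy_outside.
  exact: ltW (energy_lt0 m4 m8 dimensionE (center_le i) sp wi).
rewrite pmulr_rlt0; last by rewrite lt_def sqrf_eq0 aj sqr_ge0.
by apply: (energy_lt0 m4 m8 dimensionE (center_le j) sp); rewrite wp.
Qed.

Lemma Q_c_combined0 : Q_c R M k l (split_field M k l (combined_chi (fun=> 0))) = 0.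
Proof.
have [C C0 ->] := Q_c_combined.
transitivity (\int[@lebesgue_measure R]_(t in `]0, pi[) (0 : R)).
  apply: eq_Rintegral => t _; rewrite /radial_density /combined_energy big1.
    by rewrite mul0r if_same mulr0.
  by move=> j _; rewrite expr0n mul0r.
by rewrite Rintegral_cst// mul0r.
Qed.

Lemma split_field_combination a :
  \sum_j a j *: split_field M k l (test_chi m (center j)) =
  split_field M k l (combined_chi a).
Proof.
apply/funext => p; rewrite fct_sumE.
transitivity (\sum_j a j *: split_field M k l (test_chi m (center j)) p) => //.
rewrite /split_field; case: asboolP => cp; last first.
  by rewrite big1// => j _; rewrite scaler0.
rewrite /combined_chi scaler_suml; apply: eq_bigr => j _.
by rewrite scalerA.
Qed.

End NegativeDirections.

Theorem theorem4p2 (R : realType) (k l : nat) (M : model) :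
  (2 <= k)%N -> (2 <= l)%N -> (k + l <= 8)%N ->
  forall N : nat,
  exists E : set ('rV[R]_(ambient_dim M k l) -> 'M[R]_(ambient_dim M k l)),
    [/\ subspace_of_dim N E, E `<=` TT0 R M k l &
        forall T, E T -> T <> 0 -> Q_c R M k l T < 0].
Proof.
move=> k2 l2 kl8 N.
pose e (j : 'I_N) := split_field M k l (test_chi ((k + l)%:R : R) (center j)).
exists [set \sum_i c i *: e i | c in [set: 'I_N -> R]]; split.
- exists e; split => // c ce i; apply/eqP/negP => /negP ci.
  (* A vanishing combination would have Q_c both negative and equal to 0. *)
  have := Q_c_combined_lt0 M k2 l2 kl8 ci.
  rewrite -split_field_combination -/(e _) ce.
  rewrite -[X in Q_c _ _ _ _ X < _](_ : \sum_j (fun=> 0 : R) j *: e j = _).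
    by rewrite split_field_combination Q_c_combined0// ltxx.
  by rewrite big1// => j _; rewrite scale0r.
- move=> _ [c _ <-]; rewrite split_field_combination; exact: split_field_TT0.
- move=> _ [c _ <-] ne0.
  have [j cj] : exists j, c j != 0.
    apply/existsP; apply: contra_notT ne0 => /existsPn c0.
    by rewrite big1// => j _; have := c0 j; rewrite negbK => /eqP ->; rewrite scale0r.
  by rewrite split_field_combination; exact: Q_c_combined_lt0 cj.
Qed.
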